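(* Let $\boldsymbol\Theta=\mathbb{R}^+\times\mathbb{R}^+$, let $x_c\in\mathbb{R}$ be known, and let $\boldsymbol\alpha^\star=(\alpha_1^\star,\alpha_2^\star)=(\tilde F,\tilde B)\in\boldsymbol\Theta$ be the true parameters. Let $\mathbf{I}=(I_1,\dots,I_n)$ have independent components $I_i\sim\mathrm{Poisson}(\lambda_i)$ with $\lambda_i=\lambda_i(x_c,\tilde F)=\tilde F\,g_i(x_c)+\tilde B$, so that $\bar{\mathbf{I}}=\mathbb{E}\{\mathbf{I}\}=(\lambda_1,\dots,\lambda_n)^\top$ and the covariance matrix of $\mathbf{I}$ is $K_{\mathbf{I}}=\mathrm{diag}(\lambda_1,\dots,\lambda_n)$. Consider the stochastic weighted least-squares estimator $$\tau_{SWLS}(\mathbf{I})=\operatorname*{argmin}_{\boldsymbol\alpha\in\boldsymbol\Theta}J_{SWLS}(\boldsymbol\alpha,\mathbf{I}),\qquad J_{SWLS}(\boldsymbol\alpha,\mathbf{I})=\sum_{i=1}^n\frac{1}{I_i}\,(I_i-\alpha_1g_i(x_c)-\alpha_2)^2,$$ given in closed form by $$\tau_{SWLS}(\mathbf{I})=\begin{bmatrix}\sum_i\frac{g_i^2(x_c)}{I_i}&\sum_i\frac{g_i(x_c)}{I_i}\\ \sum_i\frac{g_i(x_c)}{I_i}&\sum_i\frac1{I_i}\end{bmatrix}^{-1}\begin{bmatrix}\frac{g_1(x_c)}{I_1}&\cdots&\frac{g_n(x_c)}{I_n}\\ \frac1{I_1}&\cdots&\frac1{I_n}\end{bmatrix}\mathbf{I}.$$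 Then for any $j\in\{1,2\}$ one can determine $\epsilon'_{SWLS,j}>0$ and $\beta_{SWLS,j}$ such that $$\big|\mathbb{E}\{\tau_{SWLS,j}(\mathbf{I})\}-\alpha^\star_j\big|\le\epsilon'_{SWLS,j},$$ $$\mathrm{Var}(\tau_{SWLS,j}(\mathbf{I}))\in\Big[[\sigma^2_{SWLS}]_{(j,j)}-\beta_{SWLS,j},\ [\sigma^2_{SWLS}]_{(j,j)}+\beta_{SWLS,j}\Big],$$ with $$\sigma^2_{SWLS}=\tau_{SWLS}'(\bar{\mathbf{I}})\,K_{\mathbf{I}}\,[\tau_{SWLS}'(\bar{\mathbf{I}})]^\top,$$ $$\tau_{SWLS}'(\bar{\mathbf{I}})=-\big[\nabla^{20}J_{SWLS}(\tau_{SWLS}(\bar{\mathbf{I}}),\bar{\mathbf{I}})\big]^{-1}\,\nabla^{11}J_{SWLS}(\tau_{SWLS}(\bar{\mathbf{I}}),\bar{\mathbf{I}}),$$ where $$\nabla^{11}J_{SWLS}(\tau_{SWLS}(\bar{\mathbf{I}}),\bar{\mathbf{I}})=2\begin{bmatrix}\frac{-g_1(x_c)}{\lambda_1}&\cdots&\frac{-g_n(x_c)}{\lambda_n}\\ \frac{-1}{\lambda_1}&\cdots&\frac{-1}{\lambda_n}\end{bmatrix},$$ $$\nabla^{20}J_{SWLS}(\tau_{SWLS}(\bar{\mathbf{I}}),\bar{\mathbf{I}})=2\begin{bmatrix}\sum_{i}\frac{g_i^2(x_c)}{\lambda_i}&\sum_{i}\frac{g_i(x_c)}{\lambda_i}\\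 \sum_{i}\frac{g_i(x_c)}{\lambda_i}&\sum_{i}\frac1{\lambda_i}\end{bmatrix}.$$ The quantities $\epsilon'_{SWLS,j}$ and $\beta_{SWLS,j}$ are $$\epsilon'_{SWLS,j}=\big|\tau_{SWLS,j}(\bar{\mathbf{I}})-\alpha^\star_j\big|+\max_{t\in[0,1]}\big|\mathbb{E}\{e_j^{(t)}\}\big|,$$ $$\beta_{SWLS,j}=\max_{t\in[0,1]}\mathbb{E}\{(e_j^{(t)})^2\}+2\max_{t\in[0,1]}\Big|\mathbb{E}\Big\{\big([\tau_{SWLS}'(\bar{\mathbf{I}})]_{(j,\cdot)}(\mathbf{I}-\bar{\mathbf{I}})\big)\,e_j^{(t)}\Big\}\Big|,$$ $$e_j^{(t)}=\frac12\sum_{i=1}^n\sum_{h=1}^n\frac{\partial^2\tau_{SWLS,j}}{\partial I_i\,\partial I_h}\big(\bar{\mathbf{I}}+t(\mathbf{I}-\bar{\mathbf{I}})\big)\,(I_i-\bar I_i)(I_h-\bar I_h).$$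
   Context: Pixel model: $\phi(\cdot,\sigma)$ is the point spread function, a probability density on $\mathbb{R}$ (taken to be the centered Gaussian density with standard deviation $\sigma$), $x_1,\dots,x_n$ are pixel centers with $x_{i+1}-x_i=\Delta x>0$, and $g_i(x_c)=\int_{x_i-\Delta x/2}^{x_i+\Delta x/2}\phi(x-x_c,\sigma)\,dx$. Here $x_c$ is the source position, $\tilde F$ the source flux and $\tilde B$ the (homogeneous) background per pixel; $I_i$ is the photon count in pixel $i$. For a real function $f(\boldsymbol\alpha,\mathbf{I})$ of $\boldsymbol\alpha\in\mathbb{R}^2$ and $\mathbf{I}\in\mathbb{R}^n$, $\nabla^{20}f$ is the $2\times2$ matrix with entries $\frac{\partial^2 f}{\partial\alpha_k\partial\alpha_l}$ and $\nabla^{11}f$ is the $2\times n$ matrix with entries $\frac{\partial^2 f}{\partial\alpha_k\partial I_i}$; derivatives are taken first and then evaluated at the indicated point. $\tau_{SWLS}'(\bar{\mathbf{I}})$ is the $2\times n$ Jacobian of $\tau_{SWLS}$ at $\bar{\mathbf{I}}$. $[A]_{(j,\cdot)}$ is the $j$-th row of $A$; sums over $i$ run over $1,\dots,n$. Expectations and variances are with respect to the Poisson law of $\mathbf{I}$ above.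
   Formalization: ε'≥0, with ε'>0 if E{e_j^(t)}≠0 for some t (for n=2, g_1≠g_2, ε'=0); the inverted matrix at Ī is assumed invertible; at zero counts τ, and e^(t) at t=1, are limits from positive counts; the closed form is the argmin only when it lies in Θ (otherwise none exists). *)

(* Defs.v *)
From HB Require Import structures.
From mathcomp Require Import all_boot all_order all_algebra.
From mathcomp Require Import all_classical all_reals all_analysis.

Set Implicit Arguments.
Unset Strict Implicit.
Unset Printing Implicit Defensive.

Import Order.TTheory GRing.Theory Num.Theory.
Import numFieldNormedType.Exports.

Local Open Scope classical_set_scope.
Local Open Scope ring_scope.

Section generic.
Context {R : realType}.

Definition argmin {V : Type} (A : set V) (f : V -> R) : set V :=
  [set a | A a /\ forall b, A b -> f a <= f b].

Definition is_max01 (f : R -> \bar R) (m : R) : Prop :=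
  (exists2 t, t \in `[0, 1] & f t = m%:E) /\
  (forall t, t \in `[0, 1] -> (f t <= m%:E)%E).

Definition partial {m : nat} (i : 'I_m) (f : 'cV[R]_m -> R) (x : 'cV[R]_m) : R :=
  'D_(delta_mx i 0) f x.

Definition nabla20 {m n : nat} (f : 'cV[R]_m -> 'cV[R]_n -> R)
    (a : 'cV[R]_m) (y : 'cV[R]_n) : 'M[R]_m :=
  \matrix_(k, l) partial k (partial l (f^~ y)) a.

Definition nabla11 {m n : nat} (f : 'cV[R]_m -> 'cV[R]_n -> R)
    (a : 'cV[R]_m) (y : 'cV[R]_n) : 'M[R]_(m, n) :=
  \matrix_(k, i) partial k (fun b => partial i (f b) y) a.

Definition jacobian_mx {m n : nat} (f : 'cV[R]_n -> 'cV[R]_m) (y : 'cV[R]_n) :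
    'M[R]_(m, n) :=
  \matrix_(k, i) partial i (fun z => f z k 0) y.

Definition mutually_independent {d} {T : measurableType d} {P : probability T R}
    {d'} {U : measurableType d'} {n : nat} (X : 'I_n -> {RV P >-> U}) : Prop :=
  forall (J : {set 'I_n}) (A : 'I_n -> set U), (forall i, measurable (A i)) ->
    P (\bigcap_(i in [set` J]) (X i @^-1` A i)) =
    (\prod_(i in J) P (X i @^-1` A i))%E.

Definition positive_cV {n : nat} (y : 'cV[R]_n) : bool :=
  [forall i, 0 < y i 0].

End generic.

Section pixel_model.
Context {R : realType} {n : nat}.

Definition pixel_response (sigma dx : R) (x : 'I_n -> R) (xc : R) (i : 'I_n) : R :=
  \int[lebesgue_measure]_(z in `[x i - dx / 2, x i + dx / 2])
    normal_pdf 0 sigma (z - xc).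

Variable g : 'I_n -> R.

Definition J_SWLS (a : 'cV[R]_2) (y : 'cV[R]_n) : R :=
  \sum_(i < n) 1 / y i 0 * (y i 0 - a 0 0 * g i - a 1 0) ^+ 2.

(* Row 0 is (g_1, ..., g_n), row 1 is (1, ..., 1). *)
Definition design (k : 'I_2) (i : 'I_n) : R := if k == 0 then g i else 1.

Definition gram (y : 'cV[R]_n) : 'M[R]_2 :=
  \matrix_(k, l) \sum_(i < n) design k i * design l i / y i 0.

Definition weighted_design (y : 'cV[R]_n) : 'M[R]_(2, n) :=
  \matrix_(k, i) (design k i / y i 0).

Definition SWLS_closed_form (y : 'cV[R]_n) : 'cV[R]_2 :=
  invmx (gram y) *m weighted_design y *m y.

(* Poisson counts vanish with positive probability and the weights 1/y_i are
   then undefined.  At such a boundary point of the orthant the estimator is the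
   limit of the closed form from the open positive orthant, i.e. the minimizer of
   J_SWLS in the limit of infinite weight on the null pixels; it must not be read
   with the library convention 0^-1 = 0, which would drop these pixels. *)
Definition tau_SWLS (y : 'cV[R]_n) : 'cV[R]_2 :=
  if positive_cV y then SWLS_closed_form y
  else \col_k lim (SWLS_closed_form z k 0 @[z --> within [set z | positive_cV z] (nbhs y)]).

Definition segment (y0 y : 'cV[R]_n) (t : R) : 'cV[R]_n := y0 + t *: (y - y0).

Definition remainder_formula (j : 'I_2) (y0 y : 'cV[R]_n) (t : R) : R :=
  1 / 2 * \sum_(i < n) \sum_(h < n)
    partial i (partial h (fun z => tau_SWLS z j 0)) (segment y0 y t)
    * (y i 0 - y0 i 0) * (y h 0 - y0 h 0).

(* For y0 > 0 and y >= 0 the segment leaves the open positive orthant only at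
   t = 1, when some y_i = 0; the value there is the limit as t tends to 1. *)
Definition remainder (j : 'I_2) (y0 y : 'cV[R]_n) (t : R) : R :=
  if positive_cV (segment y0 y t) then remainder_formula j y0 y t
  else lim (remainder_formula j y0 y u @[u --> t^'-]).

End pixel_model.

Definition Theta {R : realType} : set 'cV[R]_2 :=
  [set a | 0 < a 0 0 /\ 0 < a 1 0].

(* Main.v *)
(* Away from null counts the estimator solves the normal equations
   [gram y *m a = c] with a constant right-hand side, so it is a rational function
   of the counts. Along the segment from the mean to a count vector y it becomes a
   quotient of two polynomials in t; after cancelling the power of 1 - t produced by
   the null counts of y, the denominator is bounded below on [0, 1] uniformly in y,
   hence the value and its first two derivatives are continuous up to t = 1 and grow
   at most polynomially in y. Poisson moments being finite, expectations can be
   differentiated under the integral sign. If r is the first-order Taylor remainder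
   of the estimator at the mean and X has polynomial growth, Rolle's theorem gives
   E[X r] = E[X e_t] for some t. Taking X = 1, X = the linear term and X = r
   (with Cauchy-Schwarz) yields the bounds on the bias and on the variance. *)
Require Import Defs.
From HB Require Import structures.
From mathcomp Require Import all_boot all_order all_algebra.
From mathcomp Require Import all_classical all_reals all_analysis.
From mathcomp Require Import measurable_realfun ring lra.
Set Implicit Arguments.
Unset Strict Implicit.
Unset Printing Implicit Defensive.

Import Order.TTheory GRing.Theory Num.Theory.
Import numFieldNormedType.Exports.

Local Open Scope classical_set_scope.
Local Open Scope ring_scope.

(** * Closed form of the estimator *)

Section closed_form.
Context {R : realType} {n : nat}.
Variable g : 'I_n -> R.
Implicit Types (y z : 'cV[R]_n) (a : 'cV[R]_2).

(** The obstacle is that counts vanish with positive probability: at [t = 1] the segment then meets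
    the boundary of the orthant, where the Gram matrix blows up, and every bound must still be
    uniform in [y]. Writing numerator and denominator as sums over pairs of pixels settles this. The
    terms of the denominator are nonnegative, so a single pair bounds it from below, and pairs with
    equal responses drop out. Hence the power of [1 - t] to cancel is the largest number of null
    counts in a pair with distinct responses. The remaining factors are bounded below because a
    nonzero count is at least 1. At the mean, the data lie exactly on the model. The estimator then
    returns the true parameters, and the residuals vanish, which reduces both the Jacobian and the
    mixed derivative of the criterion to the weighted design. The three choices of [X] produce three
    unrelated values of [t]; this is why the bounds carry separate maxima over [0, 1]. *)

Definition wsum (f : 'I_n -> R) z : R := \sum_i f i / z i 0.

Definition gdet (g0 : R) z : R :=
  wsum (fun i => (g i - g0) ^+ 2) z * wsum (fun=> 1) z
  - wsum (fun i => g i - g0) z ^+ 2.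

(* The estimator written for the responses [g i - g0]: its coordinates are [slope]
   and [level - g0 * slope]. The freedom in [g0] matters when all null pixels share
   the response [g0]. *)
Definition slope (g0 : R) z : R :=
  (wsum (fun=> 1) z * \sum_i (g i - g0) - n%:R * wsum (fun i => g i - g0) z)
  / gdet g0 z.

Definition level (g0 : R) z : R :=
  (wsum (fun i => (g i - g0) ^+ 2) z * n%:R
   - wsum (fun i => g i - g0) z * \sum_i (g i - g0)) / gdet g0 z.

Lemma positive_cVP z : reflect (forall i, 0 < z i 0) (positive_cV z).
Proof. exact: forallP. Qed.

Lemma ord2P (P : 'I_2 -> Prop) : P 0 -> P 1 -> forall k, P k.
Proof.
move=> P0 P1 k; have [->|->] // : k = 0 \/ k = 1.
by case: k => -[|[|//]] ?; [left|right]; exact/val_inj.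
Qed.

Lemma wsum_lin (p q : R) (f h : 'I_n -> R) z :
  wsum (fun i => p * f i + q * h i) z = p * wsum f z + q * wsum h z.
Proof.
rewrite /wsum !mulr_sumr -big_split; apply: eq_bigr => i _ /=.
by rewrite mulrDl !mulrA.
Qed.

Lemma gramE z k l : gram g z k l = wsum (fun i => design g k i * design g l i) z.
Proof. by rewrite mxE. Qed.

Lemma wsum_shift1 g0 z :
  wsum (fun i => g i - g0) z = wsum g z - g0 * wsum (fun=> 1) z.
Proof.
rewrite -[wsum g z]mul1r -mulNr -wsum_lin; apply: eq_bigr => i _.
by rewrite mul1r mulr1.
Qed.

Lemma wsum_shift2 g0 z : wsum (fun i => (g i - g0) ^+ 2) z =
  wsum (fun i => g i * g i) z - 2 * g0 * wsum g z + g0 ^+ 2 * wsum (fun=> 1) z.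
Proof.
rewrite -[in X in _ = _ - X * _ + _](mulrC g0) -mulNr -[X in X + _ + _]mul1r -wsum_lin.
rewrite -[X in X + _]mul1r -wsum_lin; apply: eq_bigr => i _; congr (_ / _); ring.
Qed.

Lemma gram00 z : gram g z 0 0 = wsum (fun i => g i * g i) z.
Proof. by rewrite gramE. Qed.
Lemma gram01 z : gram g z 0 1 = wsum g z.
Proof. by rewrite gramE; apply: eq_bigr => i _; rewrite /design /= mulr1. Qed.
Lemma gram10 z : gram g z 1 0 = wsum g z.
Proof. by rewrite gramE; apply: eq_bigr => i _; rewrite /design /= mul1r. Qed.
Lemma gram11 z : gram g z 1 1 = wsum (fun=> 1) z.
Proof. by rewrite gramE; apply: eq_bigr => i _; rewrite /design /= mul1r. Qed.

(** Shifting the responses by [g0] is a unimodular change of the design, so the determinant is the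
    same for every [g0]. *)
Lemma det_gram g0 z : \det (gram g z) = gdet g0 z.
Proof.
rewrite (expand_det_row _ 0) !big_ord_recl big_ord0 /cofactor !det_mx11 !mxE /=.
rewrite -!/(wsum _ _) /gdet wsum_shift1 wsum_shift2.
have -> : lift 0 (0 : 'I_1) = 1 :> 'I_2 by exact/val_inj.
have -> : lift 1 (0 : 'I_1) = 0 :> 'I_2 by exact/val_inj.
rewrite -!gramE gram00 gram01 gram10 gram11 /=.
rewrite expr0 expr1; ring.
Qed.

(** Lagrange's identity: it exhibits the determinant as a sum of squares over pairs of pixels,
    positive as soon as two responses differ. *)
Lemma gdetE z : 2 * gdet 0 z = \sum_i \sum_h (g i - g h) ^+ 2 / (z i 0 * z h 0).
Proof.
transitivity (\sum_i \sum_h (g i * g i / z i 0 * (1 / z h 0)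
   + 1 / z i 0 * (g h * g h / z h 0) - 2 * (g i / z i 0 * (g h / z h 0)))).
  have -> : 2 * gdet 0 z = wsum (fun i => g i * g i) z * wsum (fun=> 1) z
      + wsum (fun=> 1) z * wsum (fun i => g i * g i) z
      - 2 * (wsum g z * wsum g z).
    by rewrite /gdet wsum_shift1 wsum_shift2; ring.
  rewrite /wsum !big_distrlr /= mulr_sumr -big_split -sumrB.
  apply: eq_bigr => i _ /=; rewrite mulr_sumr -big_split -sumrB.
  by apply: eq_bigr.
apply: eq_bigr => i _; apply: eq_bigr => h _; rewrite invfM.
ring.
Qed.

Lemma gdet_gt0 z i h : g i != g h -> positive_cV z -> 0 < gdet 0 z.
Proof.
move=> gih /positive_cVP z0; rewrite -(pmulr_rgt0 _ (ltr0Sn R 1)) gdetE.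
have t0 k l : 0 <= (g k - g l) ^+ 2 / (z k 0 * z l 0).
  by rewrite divr_ge0 ?sqr_ge0// mulr_ge0 ?ltW.
rewrite (bigD1 i)//= (bigD1 h)//= -addrA ltr_wpDr//.
  by rewrite addr_ge0 ?sumr_ge0// => k _; rewrite sumr_ge0.
by apply: divr_gt0; [rewrite exprn_even_gt0//= subr_eq0 | exact: mulr_gt0].
Qed.

Lemma mul_mx2E (A : 'M[R]_2) (v : 'cV[R]_2) k :
  (A *m v) k 0 = A k 0 * v 0 0 + A k 1 * v 1 0.
Proof.
rewrite mxE !big_ord_recl big_ord0 addr0.
by have -> : lift 0 (0 : 'I_1) = 1 :> 'I_2 by exact/val_inj.
Qed.

Lemma weighted_designE z : positive_cV z ->
  weighted_design g z *m z = \col_k \sum_i design g k i.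
Proof.
move=> /positive_cVP z0; apply/colP => k; rewrite !mxE; apply: eq_bigr => i _.
by rewrite mxE divfK// gt_eqF.
Qed.

Lemma gram_unit g0 z : (gram g z \in unitmx) = (gdet g0 z != 0).
Proof. by rewrite unitmxE unitfE (det_gram g0). Qed.

(** Invertibility at one data vector becomes a condition on the responses alone, which gives back
    invertibility at every positive data vector. *)
Lemma gram_unit_neq z : gram g z \in unitmx -> exists i h, g i != g h.
Proof.
move=> gz; apply: contrapT => /forallNP gg; move: gz; rewrite (gram_unit 0).
move/eqP; apply; apply/eqP.
rewrite -(inj_eq (mulfI (lt0r_neq0 (ltr0Sn R 1)))) mulr0 gdetE.
rewrite big1// => i _; rewrite big1// => h _.
have /forallNP/(_ h)/negP := gg i; rewrite negbK => /eqP ->.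
by rewrite subrr expr0n mul0r.
Qed.

(** Cramer's rule for the model written as [slope * (g i - g0) + level]; expanding in [g i] and 1
    produces the correction [- g0 * slope]. *)
Lemma SWLS_closed_formE g0 z : positive_cV z -> gdet g0 z != 0 ->
  SWLS_closed_form g z =
  \col_k (if k == 0 then slope g0 z else level g0 z - g0 * slope g0 z).
Proof.
move=> z0 gz; rewrite /SWLS_closed_form -mulmxA weighted_designE//.
set v := (RHS); apply: (canLR (mulKmx _)); first by rewrite (gram_unit g0).
have v0 : v 0 0 = slope g0 z by rewrite mxE.
have v1 : v 1 0 = level g0 z - g0 * slope g0 z by rewrite mxE.
have sE : \sum_i (g i - g0) = \sum_i g i - n%:R * g0.
  by rewrite sumrB sumr_const card_ord mulr_natl.
apply/colP; apply: ord2P; rewrite mul_mx2E mxE.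
- rewrite gram00 gram01 v0 v1 /slope /level.
  move: gz; rewrite /gdet !wsum_shift1 wsum_shift2 sE /design /= => gz.
  by field.
- rewrite gram10 gram11 v0 v1 /slope /level.
  move: gz; rewrite /gdet !wsum_shift1 wsum_shift2 sE /design /= => gz.
  rewrite sumr_const card_ord.
  by field.
Qed.

End closed_form.

(** * Minimality of the closed form over the open quadrant *)

Section argmin.
Context {R : realType} {n : nat}.
Variable g : 'I_n -> R.
Implicit Types (y z : 'cV[R]_n) (a : 'cV[R]_2).

Lemma normal_equations z : positive_cV z -> gram g z \in unitmx ->
  gram g z *m SWLS_closed_form g z = \col_k \sum_i design g k i.
Proof.
move=> z0 gz; rewrite /SWLS_closed_form -mulmxA weighted_designE//.
exact: mulKVmx.
Qed.

Lemma SWLS_orthogonality z (b : 'cV[R]_2) :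
  positive_cV z -> gram g z \in unitmx ->
  let m i := SWLS_closed_form g z 0 0 * g i + SWLS_closed_form g z 1 0 in
  \sum_i (z i 0 - m i) / z i 0 * (b 0 0 * g i + b 1 0) = 0.
Proof.
move=> z0 gz m; have /positive_cVP z1 := z0.
have H k : \sum_i (z i 0 - m i) / z i 0 * design g k i = 0.
  have /(congr1 (fun M : 'cV[R]_2 => M k 0)) := normal_equations z0 gz.
  rewrite mul_mx2E [RHS]mxE => H; rewrite -[RHS](subrr (\sum_i design g k i)) -{2}H.
  rewrite !gramE /wsum !mulr_suml -big_split -sumrB. apply: eq_bigr => i _ /=.
  rewrite /m (_ : design g 0 i = g i)// (_ : design g 1 i = 1)//.
  field; exact/lt0r_neq0/z1.
transitivity (b 0 0 * \sum_i (z i 0 - m i) / z i 0 * design g 0 i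
    + b 1 0 * \sum_i (z i 0 - m i) / z i 0 * design g 1 i); last first.
  by rewrite !H !mulr0 addr0.
rewrite !mulr_sumr -big_split; apply: eq_bigr => i _ /=.
rewrite /design /=; ring.
Qed.

(** Pythagoras: the cross term vanishes because the weighted residuals are orthogonal to the
    design. *)
Lemma J_SWLS_decomposition z a : positive_cV z -> gram g z \in unitmx ->
  let b := a - SWLS_closed_form g z in
  J_SWLS g a z = J_SWLS g (SWLS_closed_form g z) z
    + \sum_i (b 0 0 * g i + b 1 0) ^+ 2 / z i 0.
Proof.
move=> z0 gz b; have /positive_cVP z1 := z0.
have := SWLS_orthogonality b z0 gz => /= /(congr1 ( *%R 2)).
rewrite mulr0 => H; rewrite -[LHS]addr0 -[X in _ + X = _]H mulr_sumr /J_SWLS -!big_split.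
apply: eq_bigr => i _ /=; rewrite /b !mxE; field; exact/lt0r_neq0/z1.
Qed.

(** Up to a constant, the criterion is a positive definite quadratic form [Q] in [a - s]. Since
    [Theta] is open, a small move from [a] towards [s] stays in [Theta] and lowers the criterion
    unless [a = s]. If [s] lies outside [Theta], both sides are empty. *)
Lemma argmin_Theta z i h : g i != g h -> positive_cV z ->
  argmin Theta (J_SWLS g ^~ z) = Theta `&` [set SWLS_closed_form g z].
Proof.
move=> gih z0; have /positive_cVP z1 := z0.
have gz : gram g z \in unitmx by rewrite (gram_unit _ 0) gt_eqF// (gdet_gt0 gih).
set s := SWLS_closed_form g z.
pose Q (b : 'cV[R]_2) := \sum_i (b 0 0 * g i + b 1 0) ^+ 2 / z i 0.
have Jd a : J_SWLS g a z = J_SWLS g s z + Q (a - s) by exact: J_SWLS_decomposition.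
clearbody s.
have Q0 b : 0 <= Q b.
  by apply: sumr_ge0 => k _; rewrite divr_ge0 ?sqr_ge0// ltW.
have Q1 b : Q b = 0 -> b = 0.
  move=> /eqP; rewrite psumr_eq0; last by move=> k _; rewrite divr_ge0 ?sqr_ge0// ltW.
  move=> /allP b0.
  have {}b0 k : b 0 0 * g k + b 1 0 = 0.
    have /b0 : k \in index_enum 'I_n by rewrite mem_index_enum.
    by rewrite mulf_eq0 invr_eq0 (gt_eqF (z1 k)) orbF sqrf_eq0 => /eqP.
  have b00 : b 0 0 = 0.
    have : b 0 0 * (g i - g h) = 0.
      by rewrite -[RHS](subrr (0 : R)) -{1}(b0 i) -(b0 h); ring.
    by move=> /eqP; rewrite mulf_eq0 subr_eq0 (negbTE gih) orbF => /eqP.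
  have b10 : b 1 0 = 0 by have := b0 i; rewrite b00 mul0r add0r.
  by apply/colP; apply: ord2P; rewrite mxE.
apply/seteqP; split => [a [aT amin]|a [aT /= ea]]; last first.
  by split=> // b _; rewrite ea [leRHS]Jd lerDl.
split=> //=; apply: contrapT => as_; have Qas : 0 < Q (a - s).
  by rewrite lt_neqAle Q0 andbT eq_sym; apply/eqP => /Q1/eqP; rewrite subr_eq0 => /eqP.
have [t [t0 t1 tT]] : exists t, [/\ 0 < t, t <= 1 & Theta (a + t *: (s - a))].
  have [a0 a1] := aT.
  (* [M] bounds both increments and [m] is below both coordinates of [a], so the step [m / M] moves
     each coordinate by at most [m]. The summands [a 0 0] and [a 1 0] make [M] positive and [m / M]
     at most 1. *)
  pose M := `|s 0 0 - a 0 0| + `|s 1 0 - a 1 0| + a 0 0 + a 1 0.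
  have M0 : 0 < M by rewrite /M -addrA ltr_wpDl ?addr_ge0 ?addr_gt0.
  pose m := Num.min (a 0 0) (a 1 0) / 2.
  have m0 : 0 < m by rewrite divr_gt0// lt_min a0 a1.
  have ma0 : m < a 0 0.
    have : Num.min (a 0 0) (a 1 0) <= a 0 0 by rewrite ge_min lexx.
    rewrite /m; lra.
  have ma1 : m < a 1 0.
    have : Num.min (a 0 0) (a 1 0) <= a 1 0 by rewrite ge_min lexx orbT.
    rewrite /m; lra.
  exists (m / M); split; first exact: divr_gt0.
    rewrite ler_pdivrMr// mul1r; apply/ltW/(lt_le_trans ma0); rewrite /M.
    have := normr_ge0 (s 0 0 - a 0 0); have := normr_ge0 (s 1 0 - a 1 0); lra.
  have key (u v : R) : 0 < u -> m < u -> `|v| <= M -> 0 < u + m / M * v.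
    move=> u0 mu vM; suff : - m <= m / M * v by lra.
    rewrite mulrAC ler_pdivlMr// -mulrN1 -mulrA ler_pM2l// mulN1r.
    by move: vM; rewrite ler_norml => /andP[].
  rewrite /Theta /= !mxE; split; apply: key => //; rewrite /M.
    have := normr_ge0 (s 1 0 - a 1 0); lra.
  have := normr_ge0 (s 0 0 - a 0 0); lra.
have /(_ _ tT) := amin; rewrite /= Jd [leRHS]Jd lerD2l leNgt => /negP; apply.
have -> : Q (a + t *: (s - a) - s) = (1 - t) ^+ 2 * Q (a - s).
  rewrite /Q mulr_sumr; apply: eq_bigr => k _; rewrite !mxE; ring.
rewrite -[ltRHS]mul1r ltr_pM2r// expr_lt1//; lra.
Qed.
End argmin.

(** * Limits at null counts *)

Section boundary.
Context {R : realType} {n : nat}.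
Variable g : 'I_n -> R.
Implicit Types (y z : 'cV[R]_n) (a : 'cV[R]_2).

Lemma gdet_irrel g0 z : gdet g g0 z = gdet g 0 z.
Proof. by rewrite -!det_gram. Qed.

Lemma SWLS_slope_level g0 z i h : g i != g h -> positive_cV z ->
  SWLS_closed_form g z 0 0 = slope g g0 z /\
  SWLS_closed_form g z 1 0 = level g g0 z - g0 * slope g g0 z.
Proof.
move=> gih z0; rewrite (SWLS_closed_formE (g0 := g0))// ?mxE//.
by rewrite gdet_irrel gt_eqF// (gdet_gt0 gih).
Qed.

(** A term whose datum tends to 0 is harmless only if its coefficient is 0. The choice of [g0]
    arranges this on the null pixels. *)
Lemma wsum_cvg (f : 'I_n -> R) y :
  (forall i, y i 0 = 0 -> f i = 0) -> wsum f z @[z --> nbhs y] --> wsum f y.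
Proof.
move=> fy0; rewrite /wsum; apply: cvg_big => [|i _]; first exact: add_continuous.
have [yi0|yi0] := eqVneq (y i 0) 0.
  rewrite fy0// mul0r; under eq_cvg do rewrite mul0r; exact: cvg_cst.
apply: cvgM; first exact: cvg_cst.
by apply: cvgV => //; exact: coord_continuous.
Qed.

Lemma SWLS_interior_cvg y j i h : g i != g h -> positive_cV y ->
  SWLS_closed_form g z j 0 @[z --> within [set z | positive_cV z] (nbhs y)]
    --> SWLS_closed_form g y j 0.
Proof.
move=> gih y0; have /positive_cVP y1 := y0.
have y2 (f : 'I_n -> R) : wsum f z @[z --> within [set z | positive_cV z] (nbhs y)] --> wsum f y.
  apply: cvg_within_filter; apply: wsum_cvg => k yk.
  by have := y1 k; rewrite yk ltxx.
have d0 : gdet g 0 y != 0 by rewrite gt_eqF// (gdet_gt0 gih).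
have dc : gdet g 0 z @[z --> within [set z | positive_cV z] (nbhs y)] --> gdet g 0 y.
  by apply: cvgB; [exact: cvgM|apply: cvgM].
have sc : slope g 0 z @[z --> within [set z | positive_cV z] (nbhs y)] --> slope g 0 y.
  apply: cvgM; last exact: cvgV.
  by apply: cvgB; [apply: cvgM => //; exact: cvg_cst|apply: cvgM => //; exact: cvg_cst].
have lc : level g 0 z @[z --> within [set z | positive_cV z] (nbhs y)] --> level g 0 y.
  apply: cvgM; last exact: cvgV.
  by apply: cvgB; [apply: cvgM => //; exact: cvg_cst|apply: cvgM => //; exact: cvg_cst].
have [E0 E1] := SWLS_slope_level 0 gih y0.
move: j; apply: ord2P.
- rewrite E0; apply: cvg_trans sc; apply: near_eq_cvg.
  near=> z; have z0 : positive_cV z by near: z; exact: near_withinT.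
  by have [-> _] := SWLS_slope_level 0 gih z0.
- rewrite E1 mul0r subr0; apply: cvg_trans lc; apply: near_eq_cvg.
  near=> z; have z0 : positive_cV z by near: z; exact: near_withinT.
  by have [_ ->] := SWLS_slope_level 0 gih z0; rewrite mul0r subr0.
Unshelve. all: end_near. Qed.

(* If all null pixels share the response g0, dividing numerators and denominator
   by the diverging total weight [wsum (fun=> 1) z] leaves convergent quotients. *)
Lemma SWLS_boundary_cvg1 y j g0 i h k : g i != g h -> (forall i, 0 <= y i 0) ->
  y k 0 = 0 -> (forall i, y i 0 = 0 -> g i = g0) ->
  cvg (SWLS_closed_form g z j 0 @[z --> within [set z | positive_cV z] (nbhs y)]).
Proof.
move=> gih y0 yk yg; set F := within _ _.
pose a := wsum (fun i => (g i - g0) ^+ 2).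
pose b := wsum (fun i => g i - g0).
pose c z : R := (wsum (fun=> 1) z)^-1.
have ac : a z @[z --> F] --> a y.
  by apply: cvg_within_filter; apply: wsum_cvg => l /yg ->; rewrite subrr expr0n.
have bc : b z @[z --> F] --> b y.
  by apply: cvg_within_filter; apply: wsum_cvg => l /yg ->; rewrite subrr.
have w0 z : positive_cV z -> 0 < wsum (fun=> 1) z.
  move=> /positive_cVP z0; rewrite /wsum (bigD1 k)//= ltr_pwDl ?divr_gt0//.
  by rewrite sumr_ge0// => l _; rewrite divr_ge0// ltW.
(* The null pixel [k] alone contributes [1 / z k 0] to the total weight, so [c z] is squeezed
   between 0 and [z k 0]. *)
have cc : c z @[z --> F] --> (0 : R).
  apply: (@squeeze_cvgr _ _ _ _ (cst 0) (fun z => z k 0)); last 2 first.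
  - exact: cvg_cst.
  - by rewrite -yk; apply: cvg_within_filter; exact: coord_continuous.
  near=> z; have z0 : positive_cV z by near: z; exact: near_withinT.
  have := w0 _ z0; move/positive_cVP in z0.
  rewrite /c /= => w1; rewrite invr_ge0 ltW//= -[leRHS]invrK lef_pV2 ?posrE ?invr_gt0//.
  rewrite /wsum (bigD1 k)//= div1r lerDl.
  by rewrite sumr_ge0// => l _; rewrite divr_ge0// ltW.
(* A pixel whose response differs from [g0] cannot be null; its term keeps the limit denominator
   positive. *)
have [l gl] : exists l, g l != g0.
  by have [gi|] := eqVneq (g i) g0; [exists h; rewrite -gi eq_sym|exists i].
have ay : a y - b y ^+ 2 * 0 != 0.
  rewrite mulr0 subr0 gt_eqF// /a /wsum (bigD1 l)//=.
  have yl : 0 < y l 0 by rewrite lt_neqAle y0 andbT eq_sym; apply: contra_neq gl => /yg.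
  rewrite ltr_pwDl ?divr_gt0 ?exprn_even_gt0 ?subr_eq0//=.
  by rewrite sumr_ge0// => m _; rewrite divr_ge0 ?sqr_ge0.
have dc : a z - b z ^+ 2 * c z @[z --> F] --> a y - b y ^+ 2 * 0.
  by apply: cvgB => //; apply: cvgM => //; apply: cvgM.
pose s := \sum_i (g i - g0).
have sc : (s - n%:R * b z * c z) / (a z - b z ^+ 2 * c z) @[z --> F]
    --> (s - n%:R * b y * 0) / (a y - b y ^+ 2 * 0).
  apply: cvgM; last exact: cvgV.
  apply: cvgB; first exact: cvg_cst.
  by apply: cvgM => //; apply: cvgM => //; exact: cvg_cst.
have lc : (a z * n%:R - b z * s) * c z / (a z - b z ^+ 2 * c z) @[z --> F]
    --> (a y * n%:R - b y * s) * 0 / (a y - b y ^+ 2 * 0).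
  apply: cvgM; last exact: cvgV.
  apply: cvgM => //; apply: cvgB; apply: cvgM => //; exact: cvg_cst.
have slE z : positive_cV z ->
    slope g g0 z = (s - n%:R * b z * c z) / (a z - b z ^+ 2 * c z) /\
    level g g0 z = (a z * n%:R - b z * s) * c z / (a z - b z ^+ 2 * c z).
  move=> z0; have := w0 _ z0; rewrite /slope /level -/s -/(a z) -/(b z) /c => w1.
  have : gdet g g0 z != 0 by rewrite gdet_irrel gt_eqF// (gdet_gt0 gih).
  rewrite /gdet -/(a z) -/(b z); move: (a z) (b z) (wsum _ _) w1 => A B C C0 D0.
  have D1 : A - B ^+ 2 * C^-1 != 0.
    have -> : A - B ^+ 2 * C^-1 = (A * C - B ^+ 2) / C by field; exact: lt0r_neq0.
    by rewrite mulf_neq0// invr_neq0// lt0r_neq0.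
  by split; field; rewrite (lt0r_neq0 C0) D0.
suff [v] : exists v : R, SWLS_closed_form g z j 0 @[z --> F] --> v by exact: cvgP.
move: j; apply: ord2P.
- exists ((s - n%:R * b y * 0) / (a y - b y ^+ 2 * 0)); apply: cvg_trans sc; apply: near_eq_cvg.
  near=> z; have z0 : positive_cV z by near: z; exact: near_withinT.
  by have [-> _] := SWLS_slope_level g0 gih z0; have [-> _] := slE _ z0.
- exists ((a y * n%:R - b y * s) * 0 / (a y - b y ^+ 2 * 0)
    - g0 * ((s - n%:R * b y * 0) / (a y - b y ^+ 2 * 0))).
  apply: cvg_trans (cvgB lc (cvgM (cvg_cst g0) sc)); apply: near_eq_cvg.
  near=> z; have z0 : positive_cV z by near: z; exact: near_withinT.
  by have [_ ->] := SWLS_slope_level g0 gih z0; have [-> ->] := slE _ z0.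
Unshelve. all: end_near. Qed.

(* Comparing with a = 0, the minimizer satisfies (z_i - m_i)^2 <= z_i * \sum z,
   so its model values m_i vanish in the limit on the null pixels. *)
Lemma SWLS_boundary_cvg2 y j i h : g i != g h -> (forall i, 0 <= y i 0) ->
  y i 0 = 0 -> y h 0 = 0 ->
  SWLS_closed_form g z j 0 @[z --> within [set z | positive_cV z] (nbhs y)] --> (0 : R).
Proof.
move=> gih y0 yi yh; set F := within _ _.
pose m k z := SWLS_closed_form g z 0 0 * g k + SWLS_closed_form g z 1 0.
pose tot z : R := \sum_k z k 0.
have sumc : tot z @[z --> F] --> tot y.
  apply: cvg_within_filter; apply: cvg_big => [|k _]; first exact: add_continuous.
  exact: coord_continuous.
have mc k : y k 0 = 0 -> m k z @[z --> F] --> (0 : R).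
  move=> yk; have zc : (z : 'cV[R]_n) k 0 @[z --> F] --> (0 : R).
    by rewrite -yk; apply: cvg_within_filter; exact: coord_continuous.
  have bc : Num.sqrt ((z : 'cV[R]_n) k 0 * tot z) @[z --> F] --> (0 : R).
    rewrite -[X in _ --> X]sqrtr0; apply: continuous_cvg; first exact: sqrt_continuous.
    by rewrite -[X in _ --> X](mul0r (tot y)); exact: cvgM.
  have dc : (z : 'cV[R]_n) k 0 - m k z @[z --> F] --> (0 : R).
    apply: (@squeeze_cvgr _ _ _ _ (fun z : 'cV[R]_n => - Num.sqrt (z k 0 * tot z))
        (fun z : 'cV[R]_n => Num.sqrt (z k 0 * tot z))) => //; last first.
      by rewrite -[X in _ --> X]oppr0; exact: cvgN.
    near=> z; have z0 : positive_cV z by near: z; exact: near_withinT.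
    have gz : gram g z \in unitmx by rewrite (gram_unit _ 0) gt_eqF// (gdet_gt0 gih).
    have z1 := positive_cVP _ z0.
    rewrite -ler_norml -sqrtr_sqr ler_sqrt; last first.
      by rewrite mulr_ge0 ?sumr_ge0// => *; rewrite ltW.
    rewrite -ler_pdivrMl//.
    have := J_SWLS_decomposition 0 z0 gz => /= J0.
    have -> : tot z = J_SWLS g 0 z.
      apply: eq_bigr => l _; rewrite !mxE; field; exact/lt0r_neq0/z1.
    rewrite J0; apply: (@le_trans _ _ (J_SWLS g (SWLS_closed_form g z) z)); last first.
      by rewrite lerDl sumr_ge0// => l _; rewrite divr_ge0 ?sqr_ge0// ltW.
    rewrite /J_SWLS (bigD1 k)//= -/(m k z) div1r -addrA -opprD -/(m k z) lerDl.
    by rewrite sumr_ge0// => l _; rewrite mulr_ge0 ?sqr_ge0// divr_ge0// ltW.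
  rewrite -[X in _ --> X](subrr (0 : R)).
  apply: cvg_trans (cvgB zc dc); apply: near_eq_cvg.
  by near=> z; rewrite /= subKr.
(* The model values at two null pixels with distinct responses determine the line, and both tend to
   0. *)
have sc : SWLS_closed_form g z 0 0 @[z --> F] --> (0 : R).
  have : (m i z - m h z) / (g i - g h) @[z --> F] --> (0 - 0) / (g i - g h).
    by apply: cvgMl; apply: cvgB; exact: mc.
  rewrite subrr mul0r; apply: cvg_trans; apply: near_eq_cvg.
  by near=> z; rewrite /m /=; field; rewrite subr_eq0.
move: j; apply: ord2P => //.
have : m i z - SWLS_closed_form g z 0 0 * g i @[z --> F] --> 0 - 0 * g i.
  by apply: cvgB; [exact: mc|exact: cvgMl].
rewrite mul0r subrr; apply: cvg_trans; apply: near_eq_cvg.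
by near=> z; rewrite /m /= addrC addKr.
Unshelve. all: end_near. Qed.

(** At a null count [tau_SWLS] is itself a [lim], so only existence is at stake: either all null
    pixels share one response, or two of them differ. *)
Lemma SWLS_cvg y j i h : g i != g h -> (forall i, 0 <= y i 0) ->
  SWLS_closed_form g z j 0 @[z --> within [set z | positive_cV z] (nbhs y)]
    --> tau_SWLS g y j 0.
Proof.
move=> gih y0; rewrite /tau_SWLS; case: ifPn => [yp|yp].
  exact: (SWLS_interior_cvg gih).
rewrite mxE.
have [k yk] : exists k, y k 0 = 0.
  move: yp; rewrite /positive_cV negb_forall => /existsP[k]; rewrite -leNgt => yk.
  by exists k; apply/eqP; rewrite eq_le yk y0.
have [yg|] := pselect (forall l, y l 0 = 0 -> g l = g k).
  exact: (SWLS_boundary_cvg1 (k := k) (g0 := g k) gih).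
move=> /existsNP[l /not_implyP[yl /eqP glk]].
have H := @SWLS_boundary_cvg2 y j l k glk y0 yl yk; exact: cvgP H.
Qed.

End boundary.

(** * Differential calculus on the positive orthant *)

(** The difference quotient is exactly [L + h * Q]; derivatives of expressions quadratic along a
    direction thus reduce to a ring identity. *)
Lemma is_derive_quadratic {R : realType} {V : normedModType R} (f : V -> R)
    (a v : V) (L Q : R) :
  (forall h, f (h *: v + a) = f a + h * L + h ^+ 2 * Q) -> is_derive a v f L.
Proof.
move=> fE; have E : h^-1 *: (f (h *: v + a) - f a) @[h --> 0^'] --> L.
  have H : L + h * Q @[h --> (0 : R)^'] --> L + 0 * Q.
    apply: cvgD; first exact: cvg_cst.
    by apply: cvgMl; exact: nbhs_dnbhs.
  rewrite mul0r addr0 in H; apply: cvg_trans H; apply: near_eq_cvg.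
  near=> h; have h0 : h != 0 by near: h; exact: nbhs_dnbhs_neq.
  by rewrite fE /GRing.scale /=; field.
apply: DeriveDef; first exact: cvgP E.
by rewrite /derive; apply: cvg_lim E.
Unshelve. all: end_near. Qed.

Section gradient.
Context {R : realType} {n : nat}.
Implicit Types (f k : 'cV[R]_n -> R) (y z v : 'cV[R]_n).

Definition has_grad f (G : 'I_n -> 'cV[R]_n -> R) : Prop :=
  forall z v, positive_cV z -> is_derive z v f (\sum_h v h 0 * G h z).

(** Despite the name, no continuity of the gradient is asked: directional derivatives exist on the
    positive orthant and are linear in the direction, which suffices to differentiate along
    segments. *)
Definition C1 f : Prop := exists G, has_grad f G.
Definition C2 f : Prop := exists2 G, has_grad f G & forall h, C1 (G h).

Lemma near_positive_cV z : positive_cV z -> \forall w \near z, positive_cV w.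
Proof.
move=> /positive_cVP z0.
have H i : \forall w \near z, 0 < (w : 'cV[R]_n) i 0.
  exact: (cvgr_gt _ (@coord_continuous R n 1 i 0 z)).
have H2 := @filter_forall _ 'I_n (fun i w => 0 < (w : 'cV[R]_n) i 0) (nbhs z) _ H.
by near=> w; apply/positive_cVP; near: w; exact: H2.
Unshelve. all: end_near. Qed.

Lemma has_grad_eq f k G : (forall z, positive_cV z -> f z = k z) ->
  has_grad f G -> has_grad k G.
Proof.
move=> fk fG z v z0; apply: near_eq_is_derive (fG z v z0).
by near=> w; apply: fk; near: w; exact: near_positive_cV.
Unshelve. all: end_near. Qed.

Lemma has_grad_cst (c : R) : has_grad (cst c) (fun=> cst 0).
Proof.
move=> z v _; rewrite big1; last by move=> i _; rewrite mulr0.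
exact: is_derive_cst.
Qed.

Lemma has_gradD f k G K : has_grad f G -> has_grad k K ->
  has_grad (f + k) (fun h => G h + K h).
Proof.
move=> fG kK z v z0; under eq_bigr do rewrite mulrDr.
by rewrite big_split; apply: is_deriveD; [exact: fG|exact: kK].
Qed.

Lemma has_gradM f k G K : has_grad f G -> has_grad k K ->
  has_grad (f * k) (fun h => f * K h + k * G h).
Proof.
move=> fG kK z v z0.
have := is_deriveM (fG z v z0) (kK z v z0) => H; apply: (is_derive_eq H).
rewrite !scaler_sumr -big_split; apply: eq_bigr => i _ /=.
rewrite /GRing.scale /= !fctE; ring.
Qed.

(** The gradient is kept as a product so that [C1M] applies to it verbatim in [C2V]. *)
Lemma has_gradV f G : (forall z, positive_cV z -> f z != 0) -> has_grad f G ->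
  has_grad (fun z => (f z)^-1) (fun h z => (-1) * (G h z * ((f z)^-1 * (f z)^-1))).
Proof.
move=> f0 fG z v z0; have df := fG z v z0.
have dv : derivable f z v by case: df.
apply: DeriveDef; first exact: derivableV (f0 _ z0) dv.
rewrite deriveV ?f0// derive_val /GRing.scale /= mulr_sumr.
apply: eq_bigr => i _.
rewrite -exprVn; ring.
Qed.

Lemma has_grad_coord i :
  has_grad (fun z => z i 0) (fun h => cst (h == i)%:R).
Proof.
move=> z v _; rewrite (bigD1 i)//= eqxx mulr1 big1 ?addr0; last first.
  by move=> h /negbTE ->; rewrite mulr0.
apply: (is_derive_quadratic (Q := 0)) => h; rewrite !mxE; ring.
Qed.

Lemma C1_cst (c : R) : C1 (cst c).
Proof. by exists (fun=> cst 0); exact: has_grad_cst. Qed.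

Lemma C1D f k : C1 f -> C1 k -> C1 (f + k).
Proof. by move=> [G fG] [K kK]; eexists; exact: has_gradD fG kK. Qed.

Lemma C1M f k : C1 f -> C1 k -> C1 (f * k).
Proof. by move=> [G fG] [K kK]; eexists; exact: has_gradM fG kK. Qed.

Lemma C1V f : (forall z, positive_cV z -> f z != 0) -> C1 f ->
  C1 (fun z => (f z)^-1).
Proof. by move=> f0 [G fG]; eexists; exact: has_gradV f0 fG. Qed.

Lemma C2_C1 f : C2 f -> C1 f.
Proof. by case=> G fG _; exists G. Qed.

Lemma C2_eq f k : (forall z, positive_cV z -> f z = k z) -> C2 f -> C2 k.
Proof. by move=> fk [G fG G1]; exists G => //; exact: has_grad_eq fG. Qed.

Lemma C2_cst (c : R) : C2 (cst c).
Proof. by exists (fun=> cst 0) => [|h]; [exact: has_grad_cst|exact: C1_cst]. Qed.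

Lemma C2D f k : C2 f -> C2 k -> C2 (f + k).
Proof.
move=> [G fG G1] [K kK K1]; eexists; first exact: has_gradD fG kK.
by move=> h; exact: C1D.
Qed.

Lemma C2M f k : C2 f -> C2 k -> C2 (f * k).
Proof.
move=> f2 k2; have [[G fG G1] [K kK K1]] := (f2, k2).
eexists; first exact: has_gradM fG kK.
by move=> h; apply: C1D; apply: C1M => //; exact: C2_C1.
Qed.

Lemma C2V f : (forall z, positive_cV z -> f z != 0) -> C2 f ->
  C2 (fun z => (f z)^-1).
Proof.
move=> f0 f2; have [G fG G1] := f2; eexists; first exact: has_gradV f0 fG.
have f1 := C1V f0 (C2_C1 f2).
by move=> h; exact: (C1M (C1_cst (-1)) (C1M (G1 h) (C1M f1 f1))).
Qed.

Lemma C2_sum (F : 'I_n -> 'cV[R]_n -> R) :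
  (forall i, C2 (F i)) -> C2 (fun z => \sum_i F i z).
Proof.
move=> F2; rewrite (_ : (fun z => _) = \sum_i F i); last first.
  by apply/funext => z; rewrite fct_sumE.
by apply: (big_ind C2) => //; [exact: C2_cst|exact: C2D].
Qed.

Lemma C2_coord i : C2 (fun z => z i 0).
Proof. by eexists; [exact: has_grad_coord|move=> h; exact: C1_cst]. Qed.

Lemma C2_wsum (c : 'I_n -> R) : C2 (wsum c).
Proof.
apply: C2_sum => i; apply: (C2M (C2_cst (c i))).
by apply: C2V (C2_coord i) => z /positive_cVP z0; rewrite gt_eqF.
Qed.

Lemma partial_grad f G h z : has_grad f G -> positive_cV z ->
  partial h f z = G h z.
Proof.
move=> fG z0; have := fG z (delta_mx h 0) z0 => df.
rewrite /partial derive_val (bigD1 h)//= mxE !eqxx mul1r big1 ?addr0// => k kh.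
by rewrite mxE (negbTE kh) mul0r.
Qed.

Lemma C1_is_derive f z v : C1 f -> positive_cV z ->
  is_derive z v f (\sum_h v h 0 * partial h f z).
Proof.
move=> [G fG] z0; under eq_bigr do rewrite (partial_grad _ fG)//.
exact: fG.
Qed.

Lemma C2_partial f h : C2 f -> C1 (partial h f).
Proof.
move=> [G fG /(_ h)[K GK]]; exists K; apply: has_grad_eq GK => z z0.
by rewrite (partial_grad _ fG).
Qed.

(** The difference quotient in [t] is literally the directional one along [y - y0]. *)
Lemma is_derive_segment f y0 y t (d : R) :
  is_derive (segment y0 y t) (y - y0) f d ->
  is_derive t 1 (fun s => f (segment y0 y s)) d.
Proof.
move=> fd; have E : (fun h : R => h^-1 *: (f (segment y0 y (h *: 1 + t)) - f (segment y0 y t)))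
    = (fun h : R => h^-1 *: (f (h *: (y - y0) + segment y0 y t) - f (segment y0 y t))).
  apply/funext => h; congr (_ *: (f _ - _)).
  by rewrite /segment addrCA -scalerDl /GRing.scale /= mulr1.
apply: DeriveDef; first by rewrite /derivable E; exact: ex_derive.
by rewrite /derive E; exact: derive_val.
Qed.

Lemma C1_segment f y0 y t : C1 f -> positive_cV (segment y0 y t) ->
  is_derive t 1 (fun s => f (segment y0 y s))
    (\sum_h (y - y0) h 0 * partial h f (segment y0 y t)).
Proof. by move=> f1 z0; apply: is_derive_segment; exact: C1_is_derive. Qed.

Lemma C2_segment f y0 y t : C2 f -> positive_cV (segment y0 y t) ->
  is_derive t 1 (fun s => \sum_h (y - y0) h 0 * partial h f (segment y0 y s))
    (\sum_i \sum_h partial i (partial h f) (segment y0 y t)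
       * (y - y0) i 0 * (y - y0) h 0).
Proof.
move=> f2 z0; rewrite exchange_big /= (_ : (fun s => _) =
  \sum_h fun s => (y - y0) h 0 * partial h f (segment y0 y s)); last first.
  by apply/funext => s; rewrite fct_sumE.
apply: is_derive_sum => h; have D := C1_segment (C2_partial h f2) z0.
have := is_deriveZ ((y - y0) h 0) D => H; apply: (is_derive_eq H).
rewrite /GRing.scale /= mulr_sumr; apply: eq_bigr => i _; ring.
Qed.

End gradient.

(** * The Jacobian of the estimator *)

Section jacobian.
Context {R : realType} {n : nat}.
Variable g : 'I_n -> R.
Implicit Types (y z v : 'cV[R]_n) (a : 'cV[R]_2).

Lemma C2_tau j i h : g i != g h -> C2 (fun z => tau_SWLS g z j 0).
Proof.
move=> gih.
have d2 : C2 (gdet g 0).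
  apply: C2_eq (C2D (C2M (C2_wsum (fun i => (g i - 0) ^+ 2)) (C2_wsum (fun=> 1)))
    (C2M (C2_cst (-1)) (C2M (C2_wsum (fun i => g i - 0)) (C2_wsum (fun i => g i - 0))))).
  by move=> z _; rewrite /gdet !fctE; ring.
have dV : C2 (fun z => (gdet g 0 z)^-1).
  by apply: C2V d2 => z z0; rewrite gt_eqF// (gdet_gt0 gih).
have s2 : C2 (slope g 0).
  apply: C2_eq (C2M (C2D (C2M (C2_wsum (fun=> 1)) (C2_cst (\sum_i (g i - 0))))
    (C2M (C2_cst (- n%:R)) (C2_wsum (fun i => g i - 0)))) dV).
  by move=> z _; rewrite /slope !fctE; ring.
have l2 : C2 (level g 0).
  apply: C2_eq (C2M (C2D (C2M (C2_wsum (fun i => (g i - 0) ^+ 2)) (C2_cst n%:R))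
    (C2M (C2_cst (- \sum_i (g i - 0))) (C2_wsum (fun i => g i - 0)))) dV).
  by move=> z _; rewrite /level !fctE; ring.
move: j; apply: ord2P; [apply: C2_eq s2|apply: C2_eq l2] => z z0;
  rewrite /tau_SWLS z0; have [E0 E1] := SWLS_slope_level 0 gih z0.
- by rewrite E0.
- by rewrite E1 mul0r subr0.
Qed.

Lemma is_derive_wsum (c : 'I_n -> R) z i : positive_cV z ->
  is_derive z (delta_mx i 0) (wsum c) (- c i / z i 0 ^+ 2).
Proof.
move=> z0; have G : has_grad (wsum c) (fun h z => - c h / z h 0 ^+ 2).
  move=> w v w0; rewrite (_ : wsum c = \sum_k (fun z => c k / z k 0)); last first.
    by apply/funext => u; rewrite fct_sumE.
  apply: is_derive_sum => k.
  have w1 (u : 'cV[R]_n) : positive_cV u -> u k 0 != 0 by move=> /positive_cVP u0; rewrite gt_eqF.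
  have D := has_gradM (has_grad_cst (c k)) (has_gradV w1 (@has_grad_coord R n k)) v w0.
  apply: (is_derive_eq D); rewrite (bigD1 k)//= !fctE /= eqxx big1 ?addr0.
    by rewrite mulr0 addr0 mulr1n; field; exact: w1.
  by move=> h /negbTE hk; rewrite !fctE /= hk mulr0n; ring.
have D := G z (delta_mx i 0) z0; apply: (is_derive_eq D).
by rewrite -(partial_grad i G z0) /partial; case: D.
Qed.

(** Data lying on the model solve the normal equations with their own parameters. At the mean counts
    this cancels the first term of the bias bound. *)
Lemma SWLS_model z a : positive_cV z -> gram g z \in unitmx ->
  (forall i, z i 0 = a 0 0 * g i + a 1 0) -> tau_SWLS g z = a.
Proof.
move=> z0 gz za; rewrite /tau_SWLS z0 /SWLS_closed_form -mulmxA weighted_designE//.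
apply: (canLR (mulKmx gz)); apply/colP => k; rewrite mul_mx2E !mxE !mulr_suml.
rewrite -big_split; apply: eq_bigr => i _ /=.
have := positive_cVP _ z0 i; rewrite za => /lt0r_neq0 H.
rewrite (_ : design g 0 i = g i)// (_ : design g 1 i = 1)//; field.
by [].
Qed.

(** Differentiating the normal equations, whose right-hand side is constant, gives [gram g z] times
    the Jacobian as minus the derivative of the Gram matrix applied to the estimator. That entry is
    [design g k l / z l 0 ^+ 2] times the model value, and the model value equals [z l 0] by
    hypothesis. *)
Lemma jacobian_tau z : positive_cV z -> gram g z \in unitmx ->
  (forall i, z i 0 = tau_SWLS g z 0 0 * g i + tau_SWLS g z 1 0) ->
  jacobian_mx (tau_SWLS g) z = invmx (gram g z) *m weighted_design g z.
Proof.
move=> z0 gz zm.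
have [i [h gih]] := gram_unit_neq gz.
apply: (canRL (mulKmx gz)); apply/matrixP => k l.
rewrite [RHS]mxE mxE.
have Dt m := C1_is_derive (delta_mx l 0) (C2_C1 (C2_tau m gih)) z0.
have Dtau m : is_derive z (delta_mx l 0) (fun z => tau_SWLS g z m 0)
    (jacobian_mx (tau_SWLS g) z m l).
  by apply: (is_derive_eq (Dt m)); rewrite mxE /partial; case: (Dt m).
have DG m := is_derive_wsum (fun i => design g k i * design g m i) l z0.
have D : is_derive z (delta_mx l 0)
  (wsum (fun i => design g k i * design g 0 i) * (fun z => tau_SWLS g z 0 0)
   + wsum (fun i => design g k i * design g 1 i) * (fun z => tau_SWLS g z 1 0)) 0.
  apply: near_eq_is_derive (is_derive_cst (\sum_i design g k i) z (delta_mx l 0)).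
  near=> w; have w0 : positive_cV w by near: w; exact: near_positive_cV.
  have gw : gram g w \in unitmx by rewrite (gram_unit _ 0) gt_eqF// (gdet_gt0 gih).
  have /(congr1 (fun M : 'cV[R]_2 => M k 0)) := normal_equations w0 gw.
  by rewrite mul_mx2E [RHS]mxE !gramE !fctE /= /tau_SWLS w0 => <-.
have D' := is_deriveD (is_deriveM (DG 0) (Dtau 0)) (is_deriveM (DG 1) (Dtau 1)).
have [_ E1] := D; have [_ E] := D'; rewrite E1 {E1} in E.
rewrite !big_ord_recl big_ord0 addr0.
have -> : lift 0 (0 : 'I_1) = 1 :> 'I_2 by exact/val_inj.
rewrite !gramE -[LHS]subr0 E /GRing.scale /= (_ : design g 0 l = g l)// (_ : design g 1 l = 1)//.
have -> : tau_SWLS g z 1 0 = z l 0 - tau_SWLS g z 0 0 * g l by rewrite zm addrAC subrr add0r.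
have := positive_cVP _ z0 l => /lt0r_neq0 H.
by field.
Unshelve. all: end_near. Qed.

End jacobian.

(** * Second derivatives of the criterion *)

Section nabla.
Context {R : realType} {n : nat}.
Variable g : 'I_n -> R.
Implicit Types (y z : 'cV[R]_n) (a b : 'cV[R]_2).

Definition model a i : R := a 0 0 * g i + a 1 0.

Lemma delta_model (l : 'I_2) i : model (delta_mx l 0) i = design g l i.
Proof.
by move: l; apply: ord2P; rewrite /model /design !mxE /=; ring.
Qed.

Lemma partial_J l a y :
  partial l (J_SWLS g ^~ y) a = \sum_i - 2 * (y i 0 - model a i) / y i 0 * design g l i.
Proof.
rewrite /partial; apply: derive_val.
apply: (is_derive_quadratic (Q := \sum_i design g l i ^+ 2 / y i 0)) => h.
rewrite /J_SWLS !mulr_sumr -!big_split; apply: eq_bigr => i _ /=.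
rewrite -delta_model /model !mxE; ring.
Qed.

Lemma nabla20_J a y : nabla20 (J_SWLS g) a y = 2 *: gram g y.
Proof.
apply/matrixP => k l; rewrite !mxE /partial.
have -> : (fun x => 'D_(delta_mx l 0) (J_SWLS g ^~ y) x) =
   (fun a => \sum_i - 2 * (y i 0 - model a i) / y i 0 * design g l i).
  by apply/funext => b; exact: partial_J.
apply: derive_val; apply: (is_derive_quadratic (Q := 0)) => h.
rewrite !mulr_sumr mulr0 addr0 -big_split; apply: eq_bigr => i _ /=.
rewrite -!delta_model /model !mxE; ring.
Qed.

(** With [m] the model value, each summand of the criterion is [y i 0 - 2 * m + m ^+ 2 / y i 0] on
    positive data: an affine part plus a term of a weighted sum. *)
Lemma partial_J_data i a y : positive_cV y ->
  partial i (J_SWLS g a) y = 1 - model a i ^+ 2 / y i 0 ^+ 2.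
Proof.
move=> y0; rewrite /partial; apply: derive_val.
have L : is_derive y (delta_mx i 0) (fun z : 'cV[R]_n => \sum_l (z l 0 - 2 * model a l)) 1.
  apply: (is_derive_quadratic (Q := 0)) => h; rewrite mulr0 addr0 mulr1.
  rewrite (bigD1 i)//= [in RHS](bigD1 i)//= [RHS]addrAC; congr (_ + _).
    by rewrite !mxE !eqxx /= mulr1n; ring.
  by apply: eq_bigr => l /negbTE li; rewrite !mxE li /= mulr0n; ring.
have D := is_deriveD L (is_derive_wsum (fun l => model a l ^+ 2) i y0).
apply: near_eq_is_derive (is_derive_eq D _); last by rewrite mulNr.
near=> z; have z0 : positive_cV z by near: z; exact: near_positive_cV.
rewrite !fctE -big_split; apply: eq_bigr => l _ /=.
have := positive_cVP _ z0 l => /lt0r_neq0 H.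
by rewrite /model; field.
Unshelve. all: end_near. Qed.

Lemma nabla11_J a y : positive_cV y ->
  nabla11 (J_SWLS g) a y =
  \matrix_(k, i) (- 2 * model a i * design g k i / y i 0 ^+ 2).
Proof.
move=> y0; apply/matrixP => k i; rewrite !mxE {1}/partial.
have -> : (fun b => partial i (J_SWLS g b) y) =
   (fun b => 1 - model b i ^+ 2 / y i 0 ^+ 2).
  by apply/funext => b; exact: partial_J_data.
apply: derive_val.
apply: (is_derive_quadratic (Q := - design g k i ^+ 2 / y i 0 ^+ 2)) => h.
rewrite -delta_model /model !mxE; ring.
Qed.

End nabla.

(** * The estimator along a segment *)

Section growth.
Context {R : realType} {n : nat}.
Local Notation Y := ('I_n -> nat).

(** The summand 1 makes powers increase with the exponent, so bounds of different degrees can be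
    added. *)
Definition total_counts (y : Y) : R := 1 + \sum_i (y i)%:R.

Definition polyb (f : Y -> R -> R) : Prop := exists C M, 0 <= C /\
  forall y t, 0 <= t <= 1 -> `|f y t| <= C * total_counts y ^+ M.

Lemma total_counts_ge1 y : 1 <= total_counts y.
Proof. by rewrite /total_counts lerDl sumr_ge0. Qed.

Lemma polyb_cst (c : R) : polyb (fun _ _ => c).
Proof.
by exists `|c|, 0%N; split=> // y t _; rewrite expr0 mulr1.
Qed.

Lemma polyb_t : polyb (fun _ t => t).
Proof.
exists 1, 0%N; split=> // y t /andP[t0 t1].
by rewrite expr0 mulr1 ger0_norm.
Qed.

Lemma polyb_count i : polyb (fun y _ => (y i)%:R).
Proof.
exists 1, 1%N; split=> // y t _; rewrite expr1 mul1r ger0_norm// /total_counts.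
by rewrite (bigD1 i)//= addrCA lerDl addr_ge0// sumr_ge0.
Qed.

Lemma polyb_le (f k : Y -> R -> R) : polyb f ->
  (forall y t, 0 <= t <= 1 -> `|k y t| <= `|f y t|) -> polyb k.
Proof.
move=> [C [M [C0 fC]]] kf; exists C, M; split=> // y t t01.
exact: le_trans (kf _ _ t01) (fC _ _ t01).
Qed.

Lemma polybD f k : polyb f -> polyb k -> polyb (fun y t => f y t + k y t).
Proof.
move=> [C [M [C0 fC]]] [D [N [D0 kD]]]; exists (C + D), (M + N)%N.
split=> [|y t t01]; first exact: addr_ge0.
have y1 := total_counts_ge1 y.
rewrite (le_trans (ler_normD _ _))// mulrDl lerD//.
- by rewrite (le_trans (fC _ _ t01))// ler_wpM2l// ler_weXn2l// leq_addr.
- by rewrite (le_trans (kD _ _ t01))// ler_wpM2l// ler_weXn2l// leq_addl.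
Qed.

Lemma polybM f k : polyb f -> polyb k -> polyb (fun y t => f y t * k y t).
Proof.
move=> [C [M [C0 fC]]] [D [N [D0 kD]]]; exists (C * D), (M + N)%N.
split=> [|y t t01]; first exact: mulr_ge0.
by rewrite normrM exprD mulrACA ler_pM// ?fC ?kD.
Qed.

Lemma polyb_sum (I : Type) (r : seq I) (F : I -> Y -> R -> R) :
  (forall i, polyb (F i)) -> polyb (fun y t => \sum_(i <- r) F i y t).
Proof.
move=> Fb; elim: r => [|i r IH].
  by apply: polyb_le (polyb_cst 0) _ => y t _; rewrite big_nil.
by apply: polyb_le (polybD (Fb i) IH) _ => y t _; rewrite big_cons.
Qed.

Lemma polybN f : polyb f -> polyb (fun y t => - f y t).
Proof. by move=> fb; apply: polyb_le fb _ => y t _; rewrite normrN. Qed.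

Lemma polybB f k : polyb f -> polyb k -> polyb (fun y t => f y t - k y t).
Proof. by move=> fb kb; exact: polybD fb (polybN kb). Qed.

Lemma polyb_at f t : 0 <= t <= 1 -> polyb f -> polyb (fun y _ => f y t).
Proof.
by move=> t01 [C [M [C0 fC]]]; exists C, M; split=> // y s _; exact: fC.
Qed.

(** Polynomials in [t] with coefficients of polynomial growth in the counts. Generating them
    inductively gives stability under differentiation by the Leibniz rule, which a bare bound on
    values would not. *)
Inductive pfam : (Y -> {poly R}) -> Prop :=
| pfam_C c : polyb (fun y _ => c y) -> pfam (fun y => (c y)%:P)
| pfam_X : pfam (fun=> 'X)
| pfam_D P Q : pfam P -> pfam Q -> pfam (fun y => P y + Q y)
| pfam_M P Q : pfam P -> pfam Q -> pfam (fun y => P y * Q y).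

Lemma pfam_cst (c : R) : pfam (fun=> c%:P).
Proof. exact: (pfam_C (polyb_cst c)). Qed.

Lemma pfam_eval P : pfam P -> polyb (fun y t => (P y).[t]).
Proof.
elim=> {P} [c cb||P Q _ Pb _ Qb|P Q _ Pb _ Qb].
- by apply: polyb_le cb _ => y t _; rewrite hornerC.
- by apply: polyb_le polyb_t _ => y t _; rewrite hornerX.
- by apply: polyb_le (polybD Pb Qb) _ => y t _; rewrite hornerD.
- by apply: polyb_le (polybM Pb Qb) _ => y t _; rewrite hornerM.
Qed.

Lemma pfam_ext P Q : (forall y, P y = Q y) -> pfam P -> pfam Q.
Proof. by move=> /funext ->. Qed.

Lemma pfam_deriv P : pfam P -> pfam (fun y => (P y)^`()).
Proof.
elim=> {P} [c cb||P Q Pf dP Qf dQ|P Q Pf dP Qf dQ].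
- by apply: pfam_ext (pfam_cst 0) => y; rewrite derivC.
- by apply: pfam_ext (pfam_cst 1) => y; rewrite derivX.
- by apply: pfam_ext (pfam_D dP dQ) => y; rewrite derivD.
- apply: pfam_ext (pfam_D (pfam_M dP Qf) (pfam_M Pf dQ)) => y.
  by rewrite derivM.
Qed.

Lemma pfam_B P Q : pfam P -> pfam Q -> pfam (fun y => P y - Q y).
Proof.
move=> Pf Qf; apply: pfam_ext (pfam_D Pf (pfam_M (pfam_cst (-1)) Qf)) => y.
by rewrite polyCN mulN1r.
Qed.

Lemma pfam_sum (I : Type) (r : seq I) (F : I -> Y -> {poly R}) :
  (forall i, pfam (F i)) -> pfam (fun y => \sum_(i <- r) F i y).
Proof.
move=> Ff; elim: r => [|i r IH].
  by apply: pfam_ext (pfam_cst 0) => y; rewrite big_nil.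
by apply: pfam_ext (pfam_D (Ff i) IH) => y; rewrite big_cons.
Qed.

Lemma pfam_prod (I : Type) (r : seq I) (p : pred I) (F : I -> Y -> {poly R}) :
  (forall i, pfam (F i)) -> pfam (fun y => \prod_(i <- r | p i) F i y).
Proof.
move=> Ff; elim: r => [|i r IH].
  by apply: pfam_ext (pfam_cst 1) => y; rewrite big_nil.
have [pi|pi] := boolP (p i).
  by apply: pfam_ext (pfam_M (Ff i) IH) => y; rewrite big_cons pi.
by apply: pfam_ext IH => y; rewrite big_cons (negbTE pi).
Qed.

(** An exponent varying with [y] in a finite range is resolved by a finite sum of fixed powers
    multiplied by indicators. *)
Lemma pfam_exp P (e : Y -> nat) K : pfam P -> (forall y, (e y <= K)%N) ->
  pfam (fun y => P y ^+ e y).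
Proof.
move=> Pf eK.
have Pk k : pfam (fun y => P y ^+ k).
  elim: k => [|k IH]; first exact: pfam_cst.
  by apply: pfam_ext (pfam_M Pf IH) => y; rewrite exprS.
have ek k : pfam (fun y => ((e y == k)%:R : R)%:P).
  apply: pfam_C; apply: polyb_le (polyb_cst 1) _ => y t _.
  by case: eqP => _ //=; rewrite normr0 normr1.
have := pfam_sum (index_enum 'I_K.+1) (fun k : 'I_K.+1 => pfam_M (ek k) (Pk k)).
apply: pfam_ext => y; have ey : (e y < K.+1)%N by rewrite ltnS.
rewrite (bigD1 (Ordinal ey))//= eqxx mul1r big1 ?addr0// => k kP.
rewrite (_ : (e y == k) = false) ?mul0r//.
by apply/eqP => ek'; move/eqP: kP; apply; exact/val_inj.
Qed.

Lemma polyb_inv P (c : R) : pfam P -> 0 < c ->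
  (forall y t, 0 <= t <= 1 -> c <= (P y).[t]) ->
  polyb (fun y t => ((P y).[t])^-1).
Proof.
move=> _ c0 Pc; apply: polyb_le (polyb_cst c^-1) _ => y t t01.
have := Pc y t t01 => cP; have P0 := lt_le_trans c0 cP.
by rewrite !gtr0_norm ?invr_gt0// lef_pV2 ?posrE.
Qed.

End growth.

Lemma is_derive_quotient {R : realType} (p q : {poly R}) (t : R) :
  q.[t] != 0 ->
  is_derive t 1 (fun s => p.[s] / q.[s])
    ((p^`() * q - p * q^`()).[t] / (q ^+ 2).[t]).
Proof.
move=> q0; have dq : derivable (horner q) t 1 by exact: derivable_horner.
have dV : is_derive t 1 (fun s => (q.[s])^-1) (- (q.[t]) ^- 2 *: (q^`()).[t]).
  apply: DeriveDef; first exact: derivableV.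
  by rewrite deriveV// derive_val.
have D := is_deriveM (is_derive_poly p t) dV; apply: (is_derive_eq D).
rewrite -[LHS]/(p.[t] * (- q.[t] ^- 2 * (q^`()).[t]) + q.[t]^-1 * (p^`()).[t]).
rewrite hornerD hornerN !hornerM; field.
by [].
Qed.

(** * The estimator as an average over pairs of pixels *)

Section double_sums.
Context {R : realType} {n : nat}.
Variable g : 'I_n -> R.
Implicit Types z : 'cV[R]_n.

(** Divided by [gi - gh], these are the slope and the intercept of the line through the points
    [(gi, zi)] and [(gh, zh)]. *)
Definition interp (j : 'I_2) (gi gh : R) (zi zh : R) : R :=
  if j == 0 then zi - zh else gi * zh - gh * zi.

(** An identity going back to Jacobi: the fitted line is the average of the lines through two data
    points, weighted by [(g i - g h) ^+ 2 / (z i 0 * z h 0)]. Each double sum is twice the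
    corresponding expression in [slope] or [level]. *)
Lemma SWLS_pairs z j i h : g i != g h -> positive_cV z ->
  SWLS_closed_form g z j 0 =
  (\sum_i \sum_h (g i - g h) * interp j (g i) (g h) (z i 0) (z h 0) / (z i 0 * z h 0))
  / \sum_i \sum_h (g i - g h) ^+ 2 / (z i 0 * z h 0).
Proof.
move=> gih z0; have [E0 E1] := SWLS_slope_level 0 gih z0.
have d0 : gdet g 0 z != 0 by rewrite gt_eqF// (gdet_gt0 gih).
have z1 k : z k 0 != 0 by rewrite gt_eqF// (positive_cVP _ z0).
rewrite -gdetE; move: j; apply: ord2P.
- rewrite E0 /slope.
  have -> : \sum_i \sum_h (g i - g h) * interp 0 (g i) (g h) (z i 0) (z h 0)
      / (z i 0 * z h 0) = 2 * (wsum (fun=> 1) z * \sum_i (g i - 0)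
      - n%:R * wsum (fun i => g i - 0) z).
    transitivity (\sum_i \sum_h (1 / z i 0 * (g h - 0) + (g i - 0) * (1 / z h 0)
        - (1 * ((g h - 0) / z h 0) + (g i - 0) / z i 0 * 1))); last first.
      under eq_bigr do rewrite sumrB 2!big_split /=.
      rewrite sumrB 2!big_split /= -!big_distrlr /= sumr_const card_ord -/(wsum (fun=> 1) z).
      by rewrite -/(wsum (fun i => g i - 0) z); ring.
    apply: eq_bigr => k _; apply: eq_bigr => m _; rewrite /interp /=.
    by field; rewrite !z1.
  by field.
- rewrite E1 mul0r subr0 /level.
  have -> : \sum_i \sum_h (g i - g h) * interp 1 (g i) (g h) (z i 0) (z h 0)
      / (z i 0 * z h 0) = 2 * (wsum (fun i => (g i - 0) ^+ 2) z * n%:R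
   - wsum (fun i => g i - 0) z * \sum_i (g i - 0)).
    transitivity (\sum_i \sum_h ((g i - 0) ^+ 2 / z i 0 * 1 + 1 * ((g h - 0) ^+ 2 / z h 0)
        - ((g i - 0) / z i 0 * (g h - 0) + (g i - 0) * ((g h - 0) / z h 0)))); last first.
      under eq_bigr do rewrite sumrB 2!big_split /=.
      rewrite sumrB 2!big_split /= -!big_distrlr /= sumr_const card_ord.
      by rewrite -/(wsum (fun i => (g i - 0) ^+ 2) z) -/(wsum (fun i => g i - 0) z); ring.
    apply: eq_bigr => k _; apply: eq_bigr => m _; rewrite /interp /=.
    by field; rewrite !z1.
  by field.
Qed.
End double_sums.

(** * Cancelling the null counts along the segment *)

Section family.
Context {R : realType} {n : nat}.
Variables g l : 'I_n -> R.
Hypothesis l_gt0 : forall i, 0 < l i.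
Variables i0 h0 : 'I_n.
Hypothesis gih : g i0 != g h0.
Local Notation Y := ('I_n -> nat).
Implicit Type y : Y.

Definition lam : 'cV[R]_n := \col_i l i.
Definition data y : 'cV[R]_n := \col_i (y i)%:R.
Definition null y i : nat := (y i == 0%N).

(* The coordinates [zpoly y i] of the segment from [lam] to [data y] are
   [(1 - 'X) ^+ null y i * upoly y i] with [upoly y i] bounded away from 0; clearing
   the denominators and the common power [order y] of [1 - 'X] in the sums over
   pairs of pixels leaves a denominator bounded away from 0 up to the endpoint. *)
Definition zpoly y i : {poly R} := (l i)%:P + ((y i)%:R - l i)%:P * 'X.
Definition upoly y i : {poly R} :=
  (l i)%:P + (if y i == 0%N then 0 else (y i)%:R - l i)%:P * 'X.
Definition order y : nat :=
  \max_(p : 'I_n * 'I_n | g p.1 != g p.2) (null y p.1 + null y p.2).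
Definition cofactor y i h : {poly R} :=
  (1%:P - 'X) ^+ (order y - (null y i + null y h))
  * \prod_(k | (k != i) && (k != h)) upoly y k.
Definition denom y : {poly R} :=
  \sum_i \sum_h ((g i - g h) ^+ 2)%:P * cofactor y i h.
Definition numer j y : {poly R} :=
  \sum_i \sum_h (g i - g h)%:P *
    ((if j == 0 :> 'I_2 then zpoly y i - zpoly y h
      else (g i)%:P * zpoly y h - (g h)%:P * zpoly y i) * cofactor y i h).

Lemma null_le1 y i : (null y i <= 1)%N.
Proof. exact: leq_b1. Qed.

Lemma order_le2 y : (order y <= 2)%N.
Proof. by apply/bigmax_leqP => p _; rewrite (leq_add (null_le1 _ _) (null_le1 _ _)). Qed.

Lemma pfam_zpoly i : pfam (fun y => zpoly y i).
Proof.
apply: pfam_D; [exact: pfam_cst|apply: pfam_M; [|exact: pfam_X]].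
apply: pfam_C; apply: polybB; [exact: polyb_count|exact: polyb_cst].
Qed.

Lemma pfam_upoly i : pfam (fun y => upoly y i).
Proof.
apply: pfam_D; [exact: pfam_cst|apply: pfam_M; [|exact: pfam_X]].
apply: pfam_C; apply: polyb_le (polybB (polyb_count i) (polyb_cst (l i))) _ => y t _.
by case: ifP; rewrite ?normr0.
Qed.

Lemma pfam_cofactor i h : pfam (fun y => cofactor y i h).
Proof.
apply: (@pfam_M R n (fun y => (1%:P - 'X) ^+ (order y - (null y i + null y h))) _); last first.
  by apply: pfam_prod => k; exact: pfam_upoly.
apply: (pfam_exp (K := 2)) => [|y].
  by apply: pfam_B; [exact: pfam_cst|exact: pfam_X].
by rewrite (leq_trans (leq_subr _ _))// order_le2.
Qed.

Lemma pfam_denom : pfam denom.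
Proof.
apply: pfam_sum => i; apply: pfam_sum => h.
by apply: pfam_M; [exact: pfam_cst|exact: pfam_cofactor].
Qed.

Lemma pfam_numer j : pfam (numer j).
Proof.
apply: pfam_sum => i; apply: pfam_sum => h.
have cz (c : R) k : pfam (fun y => c%:P * zpoly y k).
  exact: (pfam_M (pfam_cst c) (pfam_zpoly k)).
case: (j == 0).
- exact: (pfam_M (pfam_cst _) (pfam_M (pfam_B (pfam_zpoly i) (pfam_zpoly h))
    (pfam_cofactor i h))).
- exact: (pfam_M (pfam_cst _) (pfam_M (pfam_B (cz _ h) (cz _ i)) (pfam_cofactor i h))).
Qed.

Lemma zpoly_upoly y i t :
  (zpoly y i).[t] = (1 - t) ^+ null y i * (upoly y i).[t].
Proof.
rewrite /zpoly /upoly /null !hornerD !hornerM !hornerC hornerX.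
by have [->|_] := eqVneq (y i) 0%N; rewrite /= ?expr1 ?expr0; ring.
Qed.

Lemma segment_zpoly y t i : segment lam (data y) t i 0 = (zpoly y i).[t].
Proof.
by rewrite /segment !mxE /zpoly hornerD hornerM !hornerC hornerX mulrC.
Qed.

(** The right-hand side is the same for all pairs with distinct responses: it is the factor cleared
    from numerator and denominator. For such a pair [order y] is at least its number of nulls, so
    the truncated subtraction in [cofactor] is exact. *)
Lemma cofactor_eval y i h t : g i != g h ->
  (cofactor y i h).[t] * ((zpoly y i).[t] * (zpoly y h).[t]) =
  (1 - t) ^+ order y * \prod_k (upoly y k).[t].
Proof.
move=> gi; have ih : i != h by apply: contra_neq gi => ->.
have le : (null y i + null y h <= order y)%N.
  exact: (leq_bigmax_cond (F := fun p => null y p.1 + null y p.2)%N (i, h)).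
rewrite !zpoly_upoly /cofactor hornerM horner_exp hornerD hornerN hornerC hornerX.
rewrite horner_prod [in RHS](bigD1 i)//= [in RHS](bigD1 h) 1?eq_sym//=.
rewrite -{2}(subnK le) !exprD; ring.
Qed.

(** A nonzero count is at least 1, so [upoly y i] is either the constant [l i] or a convex
    combination of [l i] and a number at least 1. This makes the bound independent of [y]. *)
Lemma upoly_lb : exists2 c : R, 0 < c <= 1 & forall y i t, 0 <= t <= 1 ->
  c <= (upoly y i).[t].
Proof.
exists (\big[Num.min/1]_i l i).
  by rewrite bigmin_le_id andbT lt_bigmin.
move=> y i t /andP[t0 t1]; have cl := bigmin_le 1 i l; set c := \big[_/_]_i _ in cl *.
rewrite /upoly hornerD hornerM !hornerC hornerX.
have [_|yi] := eqVneq (y i) 0%N; first by rewrite mul0r addr0.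
have y1 : 1 <= (y i)%:R :> R by rewrite ler1n lt0n.
have c1 : c <= 1 := bigmin_le_id _ _ _ _.
have -> : l i + ((y i)%:R - l i) * t = (1 - t) * l i + t * (y i)%:R by ring.
have -> : c = (1 - t) * c + t * c by ring.
by rewrite lerD// ler_wpM2l ?subr_ge0// (le_trans c1).
Qed.

(** All terms are nonnegative on [0, 1], and the term of a pair attaining [order y] has no factor
    [1 - t] left; it is at least [d * c ^+ n] whatever the counts. *)
Lemma denom_lb : exists2 c : R, 0 < c & forall y t, 0 <= t <= 1 ->
  c <= (denom y).[t].
Proof.
have [c /andP[c0 c1] cu] := upoly_lb.
pose d := \big[Num.min/1]_(p : 'I_n * 'I_n | g p.1 != g p.2) (g p.1 - g p.2) ^+ 2.
have d0 : 0 < d.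
  by apply: lt_bigmin => // p gp; rewrite exprn_even_gt0//= subr_eq0.
exists (d * c ^+ n); first by rewrite mulr_gt0// exprn_gt0.
move=> y t t01; have [t0 t1] := andP t01.
(* There are at most [n] factors, and [c <= 1] allows raising the exponent to [n]. *)
have prod_lb (p : pred 'I_n) : c ^+ n <= \prod_(k | p k) (upoly y k).[t].
  apply: (@le_trans _ _ (\prod_(k | p k) c)).
    by rewrite prodr_const ler_wiXn2l ?(ltW c0)// -[leqRHS]card_ord max_card.
  by apply: ler_prod => k _; rewrite (ltW c0) cu.
have cn0 := exprn_gt0 n c0.
have cof0 i h : 0 <= (cofactor y i h).[t].
  rewrite hornerM horner_exp horner_prod hornerD hornerN hornerC hornerX.
  by rewrite mulr_ge0 ?exprn_ge0 ?subr_ge0// (le_trans (ltW cn0)).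
have [p gp op] : exists2 p : 'I_n * 'I_n, g p.1 != g p.2 &
    order y = (null y p.1 + null y p.2)%N.
  have [|p gp E] := @eq_bigmax_cond _ [pred p : 'I_n * 'I_n | g p.1 != g p.2]
      (fun p => null y p.1 + null y p.2)%N; last by exists p.
  by apply/card_gt0P; exists (i0, h0).
rewrite /denom horner_sum (bigD1 p.1)//= horner_sum (bigD1 p.2)//= -addrA.
rewrite -[leLHS]addr0 lerD//; last first.
  rewrite addr_ge0 ?sumr_ge0// => i _; last rewrite horner_sum sumr_ge0// => h _.
    by rewrite hornerM hornerC mulr_ge0 ?sqr_ge0.
  by rewrite hornerM hornerC mulr_ge0 ?sqr_ge0.
rewrite hornerM hornerC ler_pM ?(ltW d0) ?(ltW cn0)//.
  exact: (bigmin_le_cond 1 (fun p : 'I_n * 'I_n => (g p.1 - g p.2) ^+ 2) gp).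
by rewrite /cofactor op subnn expr0 mul1r horner_prod.
Qed.

Lemma tau_numer_denom j y t : (denom y).[t] != 0 ->
  positive_cV (segment lam (data y) t) ->
  tau_SWLS g (segment lam (data y) t) j 0 = (numer j y).[t] / (denom y).[t].
Proof.
move=> D0 z0; rewrite /tau_SWLS z0 (SWLS_pairs _ gih)//.
pose E := (1 - t) ^+ order y * \prod_k (upoly y k).[t].
set z := segment _ _ _ in z0 *.
have z1 i : (zpoly y i).[t] != 0.
  by rewrite -segment_zpoly gt_eqF// (positive_cVP _ z0).
have cofE i h : g i != g h -> (cofactor y i h).[t] = E / (z i 0 * z h 0).
  move=> gi; rewrite /z !segment_zpoly /E -(cofactor_eval y t gi) mulfK//.
  by rewrite mulf_neq0.
have DE : (denom y).[t] = E * \sum_i \sum_h (g i - g h) ^+ 2 / (z i 0 * z h 0).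
  rewrite /denom horner_sum mulr_sumr; apply: eq_bigr => i _.
  rewrite horner_sum mulr_sumr; apply: eq_bigr => h _; rewrite hornerM hornerC.
  have [->|gi] := eqVneq (g i) (g h); first by rewrite subrr expr0n !mul0r mulr0.
  by rewrite cofE// mulrCA.
have NE : (numer j y).[t] = E * \sum_i \sum_h
    (g i - g h) * interp j (g i) (g h) (z i 0) (z h 0) / (z i 0 * z h 0).
  rewrite /numer horner_sum mulr_sumr; apply: eq_bigr => i _.
  rewrite horner_sum mulr_sumr; apply: eq_bigr => h _; rewrite hornerM hornerC hornerM.
  have [->|gi] := eqVneq (g i) (g h); first by rewrite subrr !mul0r mulr0.
  have -> : (if j == 0 then zpoly y i - zpoly y h
      else (g i)%:P * zpoly y h - (g h)%:P * zpoly y i).[t] =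
      interp j (g i) (g h) (z i 0) (z h 0).
    by rewrite /interp /z !segment_zpoly; case: ifP => _;
      rewrite hornerD hornerN ?hornerM ?hornerC.
  rewrite cofE//; ring.
have E0 : E != 0 by apply: contraNneq D0 => E0; rewrite DE E0 mul0r.
by rewrite DE NE -mulf_div divff// mul1r.
Qed.

End family.

(** * Derivatives and endpoint values along the segment *)

Section curve.
Context {R : realType} {n : nat}.
Variables g l : 'I_n -> R.
Hypothesis l_gt0 : forall i, 0 < l i.
Variables i0 h0 : 'I_n.
Hypothesis gih : g i0 != g h0.
Local Notation Y := ('I_n -> nat).
Implicit Type y : Y.

Definition numer1 j y : {poly R} :=
  (numer g l j y)^`() * denom g l y - numer g l j y * (denom g l y)^`().
Definition denom1 y : {poly R} := denom g l y ^+ 2.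
Definition numer2 j y : {poly R} :=
  (numer1 j y)^`() * denom1 y - numer1 j y * (denom1 y)^`().
Definition denom2 y : {poly R} := denom1 y ^+ 2.

(** On [0, 1) this is the estimator along the segment; the quotient stays regular at [t = 1], where
    the segment may reach null counts. *)
Definition curve j y (t : R) : R := (numer g l j y).[t] / (denom g l y).[t].
Definition curve1 j y (t : R) : R := (numer1 j y).[t] / (denom1 y).[t].
Definition curve2 j y (t : R) : R := (numer2 j y).[t] / (denom2 y).[t].

Lemma denom_gt0 y t : 0 <= t <= 1 -> 0 < (denom g l y).[t].
Proof.
move=> t01; have [c c0 cD] := denom_lb l_gt0 gih.
exact: lt_le_trans c0 (cD y t t01).
Qed.

Lemma is_derive_curve j y t : (denom g l y).[t] != 0 ->
  is_derive t 1 (curve j y) (curve1 j y t).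
Proof. exact: is_derive_quotient. Qed.

Lemma is_derive_curve1 j y t : (denom g l y).[t] != 0 ->
  is_derive t 1 (curve1 j y) (curve2 j y t).
Proof. by move=> D0; apply: is_derive_quotient; rewrite horner_exp expf_neq0. Qed.

Lemma curve2_continuous j y t : (denom g l y).[t] != 0 ->
  {for t, continuous (curve2 j y)}.
Proof.
move=> D0; apply: cvgM; first exact: continuous_horner.
by apply: cvgV; [rewrite !horner_exp !expf_neq0|exact: continuous_horner].
Qed.

Lemma polyb_denomV : polyb (fun y t => ((denom g l y).[t])^-1).
Proof.
have [c c0 cD] := denom_lb l_gt0 gih.
exact: polyb_inv (pfam_denom g l) c0 cD.
Qed.

Lemma pfam_numer1 j : pfam (numer1 j).
Proof.
have pN := pfam_numer g l j; have pD := pfam_denom g l.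
exact: (pfam_B (pfam_M (pfam_deriv pN) pD) (pfam_M pN (pfam_deriv pD))).
Qed.

Lemma pfam_denom1 : pfam denom1.
Proof.
have pD := pfam_denom g l.
by apply: pfam_ext (pfam_M pD pD) => y; rewrite -expr2.
Qed.

Lemma pfam_numer2 j : pfam (numer2 j).
Proof.
have pN := pfam_numer1 j; have pD := pfam_denom1.
exact: (pfam_B (pfam_M (pfam_deriv pN) pD) (pfam_M pN (pfam_deriv pD))).
Qed.

Lemma polyb_curve j : polyb (curve j).
Proof. exact: (polybM (pfam_eval (pfam_numer g l j)) polyb_denomV). Qed.

Lemma polyb_curve1 j : polyb (curve1 j).
Proof.
apply: polyb_le (polybM (pfam_eval (pfam_numer1 j)) (polybM polyb_denomV polyb_denomV)) _.
by move=> y t _; rewrite /curve1 /denom1 horner_exp expr2 invfM.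
Qed.

Lemma polyb_curve2 j : polyb (curve2 j).
Proof.
have V2 := polybM polyb_denomV polyb_denomV.
apply: polyb_le (polybM (pfam_eval (pfam_numer2 j)) (polybM V2 V2)) _.
by move=> y t _; rewrite /curve2 /denom2 /denom1 !horner_exp !expr2 !invfM.
Qed.

Local Notation seg y := (segment (lam l) (data y)).

Lemma segment_gt0 y t : 0 <= t < 1 -> positive_cV (seg y t).
Proof.
move=> /andP[t0 t1]; apply/positive_cVP => i; rewrite /segment !mxE.
have -> : l i + t * ((y i)%:R - l i) = (1 - t) * l i + t * (y i)%:R by ring.
by rewrite ltr_pwDl ?mulr_gt0 ?subr_gt0// mulr_ge0.
Qed.

Lemma segment0 y : seg y 0 = lam l.
Proof. by rewrite /segment scale0r addr0. Qed.

Lemma segment1 y : seg y 1 = data y.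
Proof. by rewrite /segment scale1r addrC subrK. Qed.

(** An open condition, unlike [0 <= t <= 1]: two-sided derivatives at the endpoints require
    agreement with [curve] on a full neighbourhood. *)
Let good y t := 0 < (denom g l y).[t] /\ positive_cV (seg y t).

Let near_good y t : good y t -> \forall s \near t, good y s.
Proof.
move=> [D0 /positive_cVP z0].
have H i : \forall s \near t, 0 < (zpoly l y i).[s].
  by apply: (cvgr_gt _ (@continuous_horner R (zpoly l y i) t)); rewrite -segment_zpoly.
have H1 := @filter_forall _ 'I_n (fun i s => 0 < (zpoly l y i).[s]) (nbhs t) _ H.
have H2 : \forall s \near t, 0 < (denom g l y).[s].
  exact: (cvgr_gt _ (@continuous_horner R (denom g l y) t)).
near=> s; split; first by near: s; exact: H2.
have H3 : forall i, 0 < (zpoly l y i).[s] by near: s; exact: H1.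
by apply/positive_cVP => i; rewrite segment_zpoly.
Unshelve. all: end_near. Qed.

Let good_tau j y t : good y t ->
  tau_SWLS g (seg y t) j 0 = curve j y t.
Proof. by move=> [D0 z0]; apply: (tau_numer_denom gih) => //; exact: lt0r_neq0. Qed.

Let tau_j (j : 'I_2) (z : 'cV[R]_n) := tau_SWLS g z j 0.

(** The rational function and the estimator along the segment agree near each [good] point, so the
    quotient rule and the chain rule compute the same derivatives. *)
Lemma derive_tau_segment j y t : 0 <= t <= 1 -> positive_cV (seg y t) ->
  curve1 j y t = \sum_h (data y - lam l) h 0 * partial h (tau_j j) (seg y t) /\
  curve2 j y t = \sum_i \sum_h partial i (partial h (tau_j j)) (seg y t)
    * (data y - lam l) i 0 * (data y - lam l) h 0.
Proof.
move=> t01 z0; have gt : good y t by split=> //; exact: denom_gt0.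
have tau2 := C2_tau j gih.
have d1 s : good y s ->
  curve1 j y s = \sum_h (data y - lam l) h 0 * partial h (tau_j j) (seg y s).
  move=> gs; have [D0 zs] := gs.
  have [_ <-] := is_derive_curve j (lt0r_neq0 D0).
  have D := C1_segment (C2_C1 tau2) zs.
  have [_ //] : is_derive s 1 (curve j y)
    (\sum_h (data y - lam l) h 0 * partial h (tau_j j) (seg y s)).
  apply: near_eq_is_derive D.
  by near=> r; apply: good_tau; near: r; exact: near_good.
split; first exact: d1.
have [_ <-] := is_derive_curve1 j (lt0r_neq0 gt.1).
have D := C2_segment tau2 z0.
suff [_ //] : is_derive t 1 (curve1 j y)
  (\sum_i \sum_h partial i (partial h (tau_j j)) (seg y t)
    * (data y - lam l) i 0 * (data y - lam l) h 0) by [].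
apply: near_eq_is_derive D.
by near=> r; apply/esym/d1; near: r; exact: near_good.
Unshelve. all: end_near. Qed.

Lemma remainder_formula_curve j y t : 0 <= t <= 1 -> positive_cV (seg y t) ->
  remainder_formula g j (lam l) (data y) t = curve2 j y t / 2.
Proof.
move=> t01 z0; rewrite /remainder_formula (derive_tau_segment j t01 z0).2 mulrC mul1r.
congr (_ / _); apply: eq_bigr => i _; apply: eq_bigr => h _.
by rewrite !mxE.
Qed.

Lemma remainder_formula_cvg j y :
  remainder_formula g j (lam l) (data y) u @[u --> 1^'-] --> curve2 j y 1 / 2.
Proof.
have H : curve2 j y u / 2 @[u --> (1 : R)^'-] --> curve2 j y 1 / 2.
  apply: cvgMl; apply: cvg_at_left_filter; apply: curve2_continuous.
  by rewrite gt_eqF// denom_gt0// ler01 lexx.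
apply: cvg_trans H; apply: near_eq_cvg; near=> u.
have u1 : 0 <= u < 1 by apply/andP; split; [apply/ltW|]; near: u;
  [exact: nbhs_left_gt|exact: nbhs_left_lt].
rewrite remainder_formula_curve ?segment_gt0//.
by case/andP: u1 => -> /ltW ->.
Unshelve. all: end_near. Qed.

Lemma remainder_curve j y t : 0 <= t <= 1 ->
  remainder g j (lam l) (data y) t = curve2 j y t / 2.
Proof.
move=> t01; rewrite /remainder; case: ifPn => [z0|z0].
  exact: remainder_formula_curve.
have -> : t = 1.
  apply: contraNeq z0 => t1; apply: segment_gt0.
  by case/andP: t01 => -> t1'; rewrite lt_neqAle t1 t1'.
by apply: cvg_lim => //; exact: remainder_formula_cvg.
Qed.

Lemma tau_lam_curve j y : tau_SWLS g (lam l) j 0 = curve j y 0.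
Proof.
rewrite -(segment0 y); apply: good_tau; split.
  by apply: denom_gt0; rewrite lexx ler01.
by apply: segment_gt0; rewrite lexx ltr01.
Qed.

(** At null counts the left side is a limit over the whole orthant. The segment is one path
    realizing it, along which the estimator is [curve], continuous at 1; uniqueness of limits
    concludes. *)
Lemma tau_data_curve j y : tau_SWLS g (data y) j 0 = curve j y 1.
Proof.
have d1 : 0 < (denom g l y).[1] by apply: denom_gt0; rewrite lexx ler01.
have y0 i : 0 <= (data y : 'cV[R]_n) i 0 by rewrite mxE.
have sc : seg y t @[t --> (1 : R)^'-] --> within [set z | positive_cV z] (nbhs (data y)).
  have c1 : seg y t @[t --> (1 : R)] --> data y.
    rewrite -[X in _ --> X](segment1 y) /segment; apply: cvgD; first exact: cvg_cst.
    by apply: cvgZr_tmp; exact: cvg_id.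
  move=> A /= HA; have H := cvg_at_left_filter c1 HA.
  change (\forall u \near (1 : R)^'-, A (seg y u)).
  near=> u; have : positive_cV (seg y u) -> A (seg y u) by near: u; exact: H.
  apply; apply: segment_gt0; apply/andP; split; [apply/ltW|]; near: u;
    [exact: nbhs_left_gt|exact: nbhs_left_lt].
have H : curve j y u @[u --> (1 : R)^'-] --> tau_SWLS g (data y) j 0.
  have H0 : SWLS_closed_form g (seg y u) j 0 @[u --> (1 : R)^'-] --> tau_SWLS g (data y) j 0.
    exact: cvg_comp sc (SWLS_cvg (j := j) gih y0).
  apply: cvg_trans H0; apply: near_eq_cvg; near=> u.
  have u1 : 0 <= u < 1 by apply/andP; split; [apply/ltW|]; near: u;
    [exact: nbhs_left_gt|exact: nbhs_left_lt].
  have zu := segment_gt0 y u1.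
  rewrite /= -good_tau /tau_SWLS ?zu//; split=> //; apply: denom_gt0.
  by case/andP: u1 => -> /ltW ->.
apply: (cvg_unique _ H) => //; apply: cvg_at_left_filter.
apply: differentiable_continuous; apply/derivable1_diffP.
by have [] := is_derive_curve j (lt0r_neq0 d1).
Unshelve. all: end_near. Qed.

End curve.

(** * Moments of the Poisson counts *)

Section counts.
Context {R : realType} {n : nat}.
Context {d : measure_display} {T : measurableType d} {P : probability T R}.
Variable I : 'I_n -> {RV P >-> nat}.
Local Notation Y := ('I_n -> nat).

Definition counts (w : T) : Y := fun i => I i w.

Lemma measurable_level i (k : nat) : measurable (I i @^-1` [set k]).
Proof. by rewrite -[X in measurable X]setTI; exact: measurable_funP. Qed.

(** Finite functions into [nat] are countable, so any preimage is a countable union of intersections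
    of level sets. *)
Lemma measurable_counts d' (U : measurableType d') (f : Y -> U) :
  measurable_fun setT (fun w => f (counts w)).
Proof.
move=> _ B mB; rewrite setTI.
pose F k := if @unpickle {ffun 'I_n -> nat} k is Some y then
  if pselect (B (f y)) then \bigcap_(i in [set: 'I_n]) (I i @^-1` [set y i]) else set0
  else set0.
rewrite (_ : _ @^-1` _ = \bigcup_k F k).
  apply: bigcupT_measurable => k; rewrite /F.
  case: unpickle => [y|]; last exact: measurable0.
  case: pselect => ?; last exact: measurable0.
  apply: fin_bigcap_measurable => [|i _]; first exact: finite_finset.
  exact: measurable_level.
apply/seteqP; split => [w /= Bw|w [k _]].
  have E : [ffun i => I i w] = counts w :> (_ -> _) by apply/funext => i; rewrite ffunE.
  exists (pickle [ffun i => I i w]) => //; rewrite /F pickleK.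
  by case: pselect => [? /= i _|/=]; rewrite E.
rewrite /F; case: unpickle => [y|//]; case: pselect => // ? yw /=.
suff -> : counts w = y by [].
by apply/funext => i; exact: yw.
Qed.

Lemma integral_levels i (D : set T) (phi : T -> R) : measurable D ->
  measurable_fun D phi -> (forall w, 0 <= phi w) ->
  (\int[P]_(w in D) (phi w)%:E =
   \sum_(0 <= k <oo) \int[P]_(w in D `&` I i @^-1` [set k]) (phi w)%:E)%E.
Proof.
move=> mD mphi phi0.
have DE : D = \bigcup_k (D `&` I i @^-1` [set k]).
  by apply/seteqP; split => [w Dw|w [k _ []]//]; exists (I i w).
rewrite {1}DE; apply: ge0_integral_bigcup => //.
- by move=> k; apply: measurableI => //; exact: measurable_level.
- by rewrite -DE; exact/measurable_EFinP.
- by move=> w _; rewrite lee_fin.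
- by move=> a b _ _ [w [[_ /= <-] [_ /= <-]]].
Qed.

Variable l : 'I_n -> R.
Hypothesis l_gt0 : forall i, 0 < l i.
Hypothesis indep : mutually_independent I.
Hypothesis poisson : forall i (A : set nat), measurable A ->
  distribution P (I i) A = poisson_prob (l i) 0%N A.

Lemma level_prob i k : P (I i @^-1` [set k]) = (poisson_pmf (l i) k)%:E.
Proof.
have := @poisson i [set k] Logic.I; rewrite /distribution /pushforward => ->.
by rewrite /poisson_prob l_gt0 esum_set1// lee_fin poisson_pmf_ge0.
Qed.

Lemma levels_prob i h a b : i != h ->
  P (I i @^-1` [set a] `&` I h @^-1` [set b])
  = (poisson_pmf (l i) a * poisson_pmf (l h) b)%:E.
Proof.
move=> ih; pose A k : set nat := if k == i then [set a] else [set b].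
have hi : (h == i) = false by rewrite eq_sym; exact/negbTE.
have := indep [set i; h]%SET (A := A) (fun _ => Logic.I).
rewrite big_setU1 ?inE//= big_set1 /A eqxx hi !level_prob => H; rewrite EFinM -H {H}.
congr (P _); apply/seteqP; split => [w [wi wh] k /=|w H].
  by rewrite !inE => /orP[/eqP ->|/eqP ->]; rewrite ?eqxx ?hi.
split; [have := H i|have := H h]; rewrite /= !inE eqxx ?orbT ?hi //; exact.
Qed.

Lemma expect_fun i (f : nat -> R) : (forall k, 0 <= f k) ->
  (\int[P]_w (f (I i w))%:E = \sum_(0 <= k <oo) (f k * poisson_pmf (l i) k)%:E)%E.
Proof.
move=> f0; rewrite (integral_levels i)//; last first.
  exact: (measurable_counts (fun y => (f (y i)) : R)).
apply: eq_eseriesr => k _; rewrite setTI.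
rewrite (eq_integral (cst (f k)%:E)); last by move=> w; rewrite inE /= => ->.
rewrite integral_cst; last exact: measurable_level.
by rewrite EFinM -level_prob.
Qed.

Lemma poisson_pmfS (r : R) k : 0 < r ->
  k.+1%:R * poisson_pmf r k.+1 = r * poisson_pmf r k.
Proof.
move=> r0; rewrite /poisson_pmf r0 factS natrM exprS invfM.
have : k.+1%:R != 0 :> R by rewrite pnatr_eq0.
have : k`!%:R != 0 :> R by rewrite pnatr_eq0 -lt0n fact_gt0.
by move=> a b; field; rewrite a addrC natr1 b.
Qed.

(** The recurrence [poisson_pmfS] shifts the series by one index, the term at 0 being null. The
    moments of a single count below come from this identity. *)
Lemma chen_stein i (f : nat -> R) : (forall k, 0 <= f k) ->
  (\int[P]_w ((I i w)%:R * f (I i w))%:E = (l i)%:E * \int[P]_w (f (I i w).+1)%:E)%E.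
Proof.
move=> f0; rewrite (expect_fun i (f := fun k => k%:R * f k)); last first.
  by move=> k; rewrite mulr_ge0.
rewrite (expect_fun i (f := fun k => f k.+1))//.
have pf0 k : 0 <= poisson_pmf (l i) k by exact: poisson_pmf_ge0.
rewrite nneseries_recl//; last by move=> k _; rewrite lee_fin !mulr_ge0.
rewrite !mul0r add0e -(nneseries_addn 1); last first.
  by move=> k; rewrite lee_fin !mulr_ge0.
rewrite -nneseriesZl; last by move=> k _; rewrite lee_fin mulr_ge0.
apply: eq_eseriesr => k _; rewrite addn1 -EFinM.
by rewrite mulrAC poisson_pmfS// -mulrA [X in _ * X]mulrC.
Qed.

(** Induction on [M]: one factor [N + 1] splits into [N] and 1, [chen_stein] turns the first part
    into a moment of [N + 2], and [N + 2 <= 2 * (N + 1)] returns to the previous moment. *)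
Lemma moment_lt_pinfty i M : (\int[P]_w ((I i w).+1%:R ^+ M)%:E < +oo)%E.
Proof.
have mM k : measurable_fun setT (fun w => (I i w).+1%:R ^+ k : R).
  exact: (measurable_counts (fun y => ((y i).+1%:R ^+ k) : R)).
elim: M => [|M IH].
  under eq_integral do rewrite expr0.
  by rewrite integral_cst//= probability_setT mule1 ltry.
have -> : (\int[P]_w ((I i w).+1%:R ^+ M.+1)%:E = \int[P]_w ((I i w)%:R * (I i w).+1%:R ^+ M)%:E
    + \int[P]_w ((I i w).+1%:R ^+ M)%:E :> \bar R)%E.
  rewrite -ge0_integralD//.
  - by apply: eq_integral => w _; rewrite -EFinD exprS -natr1; congr EFin; ring.
  - exact/measurable_EFinP/(measurable_counts (fun y => ((y i)%:R * (y i).+1%:R ^+ M) : R)).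
  - exact/measurable_EFinP.
rewrite lte_add_pinfty// (chen_stein i (f := fun k => k.+1%:R ^+ M)); last first.
  by move=> k; rewrite exprn_ge0.
rewrite lte_mul_pinfty// ?lee_fin ?ltW//.
apply: (@le_lt_trans _ _ (\int[P]_w ((2 ^+ M)%:E * ((I i w).+1%:R ^+ M)%:E)))%E.
  apply: ge0_le_integral => //.
  - exact/measurable_EFinP/(measurable_counts (fun y => ((y i).+2%:R ^+ M) : R)).
  - exact/measurable_EFinP/(measurable_counts (fun y => (2 ^+ M * (y i).+1%:R ^+ M) : R)).
  - move=> w _; rewrite -EFinM lee_fin -exprMn lerXn2r ?nnegrE//.
    by rewrite -natrM ler_nat mulnS -[leqLHS]/(2 + I i w)%N leq_add2l leq_pmull.
rewrite ge0_integralZl//; last exact/measurable_EFinP.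
by rewrite lte_mul_pinfty// lee_fin exprn_ge0.
Qed.

(** The total is at most [n.+1] times the largest [(y i).+1], whose power is one of the summands on
    the right. Integrability is thus reduced to moments of single counts. *)
Lemma total_pow_le (y : Y) M :
  total_counts y ^+ M <= n.+1%:R ^+ M * (1 + \sum_i (y i).+1%:R ^+ M) :> R.
Proof.
have [m [m1 ym mM]] : exists m : nat, [/\ (0 < m)%N, forall i, (y i <= m)%N &
    m%:R ^+ M <= 1 + \sum_i (y i).+1%:R ^+ M :> R].
  have [n0|n0] := posnP #|'I_n|.
    exists 1%N; split=> // [i|]; first by have := card0_eq n0 i; rewrite inE.
    by rewrite expr1n lerDl sumr_ge0// => i _; rewrite exprn_ge0.
  have [i yi] := @bigop.eq_bigmax 'I_n (fun i => (y i).+1) n0.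
  exists (y i).+1; split=> // [k|].
    by rewrite -yi (leq_trans (leqnSn _))// (bigop.leq_bigmax k).
  rewrite (bigD1 i)//= addrCA lerDl.
  by apply: addr_ge0 => //; apply: sumr_ge0 => k _; exact: exprn_ge0.
apply: (@le_trans _ _ ((n.+1 * m)%:R ^+ M)).
  rewrite lerXn2r ?nnegrE//; first exact: le_trans (total_counts_ge1 y).
  rewrite /total_counts -natr_sum -(natrD _ 1) ler_nat mulSn leq_add//.
  by rewrite -[n in (n * _)%N]card_ord -sum_nat_const leq_sum.
by rewrite natrM exprMn ler_wpM2l// exprn_ge0.
Qed.

Lemma polyb_integrable (f : Y -> R) : polyb (fun y _ => f y) ->
  P.-integrable setT (EFin \o (fun w => f (counts w))).
Proof.
move=> [C [M [C0 fC]]].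
have iM i : P.-integrable setT (fun w => ((I i w).+1%:R ^+ M : R)%:E).
  apply/integrableP; split.
    exact/measurable_EFinP/(measurable_counts (fun y => (y i).+1%:R ^+ M : R)).
  under eq_integral do rewrite gee0_abs ?lee_fin ?exprn_ge0//.
  exact: moment_lt_pinfty.
have iG : P.-integrable setT (fun w => (C * n.+1%:R ^+ M)%:E *
    (1 + \sum_(i <- index_enum 'I_n) ((I i w).+1%:R ^+ M : R)%:E))%E.
  apply: integrableZl => //; apply: integrableD => //.
    exact: finite_measure_integrable_cst.
  exact: integrable_sum.
apply: le_integrable iG => //; first exact/measurable_EFinP/measurable_counts.
move=> w _ /=; rewrite sumEFin -EFinD -EFinM lee_fin.
rewrite (le_trans (fC _ 0 _)) ?lexx ?ler01// -mulrA.
rewrite (le_trans _ (ler_norm _))// ler_wpM2l//.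
exact: total_pow_le.
Qed.

Definition mean (f : Y -> R) : R := (\int[P]_w f (counts w))%R.

Lemma expectation_mean (f : Y -> R) : polyb (fun y _ => f y) ->
  'E_P[fun w => f (counts w)]%E = (mean f)%:E.
Proof.
move=> fb; rewrite unlock /mean /Rintegral fineK//.
exact: integrable_fin_num (polyb_integrable fb).
Qed.

Lemma meanD f k : polyb (fun y _ => f y) -> polyb (fun y _ => k y) ->
  mean (fun y => f y + k y) = mean f + mean k.
Proof. by move=> fb kb; apply: RintegralD => //; exact: polyb_integrable. Qed.

Lemma meanZ (c : R) f : polyb (fun y _ => f y) ->
  mean (fun y => c * f y) = c * mean f.
Proof. by move=> fb; apply: RintegralZl => //; exact: polyb_integrable. Qed.

Lemma mean_cst (c : R) : mean (fun=> c) = c.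
Proof.
rewrite /mean Rintegral_cst//= probability_setT mulr1.
by [].
Qed.

Lemma mean_sum (J : Type) (r : seq J) (F : J -> Y -> R) :
  (forall i, polyb (fun y _ => F i y)) ->
  mean (fun y => \sum_(i <- r) F i y) = \sum_(i <- r) mean (F i).
Proof.
move=> Fb; elim: r => [|i r IH].
  rewrite big_nil -[RHS]mean_cst; congr mean; apply/funext => y.
  by rewrite big_nil.
rewrite big_cons -IH -meanD//; last exact: polyb_sum.
by congr mean; apply/funext => y; rewrite big_cons.
Qed.

Lemma mean_le f k : polyb (fun y _ => f y) -> polyb (fun y _ => k y) ->
  (forall y, f y <= k y) -> mean f <= mean k.
Proof.
by move=> fb kb fk; apply: le_Rintegral => //; exact: polyb_integrable.
Qed.

Lemma mean_count i : mean (fun y => (y i)%:R) = l i.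
Proof.
have := chen_stein i (f := fun=> 1) (fun=> ler01).
rewrite (_ : (\int[P]_w (1 : R)%:E)%E = 1%E); last first.
  by rewrite integral_cst//= probability_setT mul1e.
rewrite mule1 => H; rewrite /mean /Rintegral.
under eq_integral do rewrite -[_%:R]mulr1.
by rewrite H.
Qed.

Lemma mean_count_sqr i : mean (fun y => (y i)%:R * (y i)%:R) = l i * l i + l i.
Proof.
have := chen_stein i (f := fun k => k%:R) (fun=> ler0n _ _).
rewrite /mean /Rintegral => ->.
have fb : polyb (fun (y : Y) (t : R) => (y i).+1%:R).
  apply: polyb_le (polybD (polyb_cst 1) (polyb_count i)) _ => y t _.
  by rewrite -natr1 addrC.
have := expectation_mean fb; rewrite unlock => ->.
rewrite -EFinM /= (_ : mean _ = 1 + l i); first by ring.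
have -> : (fun y : Y => (y i).+1%:R : R) = (fun y => 1 + (y i)%:R).
  by apply/funext => y; rewrite -natr1 addrC.
by rewrite meanD ?mean_cst ?mean_count//; [exact: polyb_cst|exact: polyb_count].
Qed.

(** Independence enters through [levels_prob]: summing over the levels of [I i], then of [I h], the
    double series factors. *)
Lemma mean_count_prod i h : i != h ->
  mean (fun y => (y i)%:R * (y h)%:R) = l i * l h.
Proof.
move=> ih; rewrite /mean /Rintegral.
have mI k : measurable_fun setT (fun w => (I k w)%:R : R).
  exact: (measurable_counts (fun y => (y k)%:R : R)).
have mih : measurable_fun setT (fun w => (I i w)%:R * (I h w)%:R : R).
  exact: measurable_funM.
have p0 k a : 0 <= poisson_pmf (l k) a := poisson_pmf_ge0 _ _.
have Lh : (\sum_(0 <= b <oo) (b%:R * poisson_pmf (l h) b)%:E)%E = (l h)%:E.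
  rewrite -expect_fun//; have := expectation_mean (polyb_count h).
  by rewrite unlock mean_count.
rewrite (integral_levels i)//.
rewrite (_ : (\sum_(0 <= a <oo) _)%E = (\sum_(0 <= a <oo)
    (l h)%:E * (a%:R * poisson_pmf (l i) a)%:E)%E).
  rewrite nneseriesZl; last by move=> a _; rewrite lee_fin mulr_ge0.
  rewrite -expect_fun//; have := expectation_mean (polyb_count i).
  by rewrite unlock mean_count => ->; rewrite mulrC.
apply: eq_eseriesr => a _; rewrite setTI -Lh.
rewrite muleC -nneseriesZl; last by move=> b _; rewrite lee_fin mulr_ge0.
rewrite (integral_levels h)//; last 2 first.
- exact: measurable_level.
- exact: measurable_funTS mih.
apply: eq_eseriesr => b _.
rewrite (eq_integral (cst (a%:R * b%:R)%:E)); last first.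
  by move=> w; rewrite inE /= => -[<- <-].
rewrite integral_cst; last by apply: measurableI; exact: measurable_level.
have := levels_prob a b ih => /= ->.
by rewrite -!EFinM; congr EFin; ring.
Qed.

Lemma mean_covariance i h :
  mean (fun y => ((y i)%:R - l i) * ((y h)%:R - l h)) = if i == h then l i else 0.
Proof.
have b1 k := @polyb_count R n k.
have -> : (fun y : Y => ((y i)%:R - l i) * ((y h)%:R - l h)) =
    (fun y => ((y i)%:R * (y h)%:R + ((- l i) * (y h)%:R + (- l h) * (y i)%:R)) + l i * l h).
  by apply/funext => y; ring.
have b2 k m := polybM (b1 k) (b1 m).
have b3 c k := polybM (polyb_cst c) (b1 k).
rewrite meanD; [|exact: polybD (b2 _ _) (polybD (b3 _ _) (b3 _ _))|exact: polyb_cst].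
rewrite meanD; [|exact: b2|exact: polybD (b3 _ _) (b3 _ _)].
rewrite meanD; [|exact: b3|exact: b3].
rewrite (meanZ (- l i) (b1 h)) (meanZ (- l h) (b1 i)).
rewrite !mean_count mean_cst.
have [->|ih] := eqVneq i h; first by rewrite mean_count_sqr; ring.
by rewrite mean_count_prod//; ring.
Qed.

End counts.

(** * Mean-value form of the expected Taylor remainder *)

Lemma is_derive1_continuous {R : realType} (f : R -> R) (t df : R) :
  is_derive t 1 f df -> {for t, continuous f}.
Proof.
by move=> [D _]; apply: differentiable_continuous; exact/derivable1_diffP.
Qed.

Section mean_value.
Context {R : realType} {n : nat}.
Context {d : measure_display} {T : measurableType d} {P : probability T R}.
Variable I : 'I_n -> {RV P >-> nat}.
Local Notation Y := ('I_n -> nat).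
Variable l : 'I_n -> R.
Hypothesis l_gt0 : forall i, 0 < l i.
Hypothesis indep : mutually_independent I.
Hypothesis poisson : forall i (A : set nat), measurable A ->
  distribution P (I i) A = poisson_prob (l i) 0%N A.
Implicit Types f k : Y -> R -> R.

Local Notation mean := (mean I).

(** Bounds and continuity are available on [0, 1] only; composing with this projection gives
    functions continuous on the whole line, endpoints included. *)
Definition clamp (t : R) : R := Num.max 0 (Num.min 1 t).

Lemma clamp_itv t : 0 <= clamp t <= 1.
Proof.
by rewrite /clamp le_max lexx /= ge_max ler01 /= ge_min lexx.
Qed.

Lemma clamp_id t : 0 <= t <= 1 -> clamp t = t.
Proof. by move=> /andP[t0 t1]; rewrite /clamp min_r// max_r. Qed.

Lemma clamp_continuous : continuous clamp.
Proof.
move=> t; have C c : {for t, continuous (cst c : R -> R)} by exact: cst_continuous.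
have H : {for t, continuous ((cst 1 : R -> R) \min id)}.
  by apply: continuous_min => //; exact: cvg_id.
by have := continuous_max (C 0) H.
Qed.

Lemma polyb_dominated f : polyb f -> exists2 G : Y -> R,
  P.-integrable setT (EFin \o (fun w => G (counts I w))) &
  (forall y, 0 <= G y) /\ forall y t, 0 <= t <= 1 -> `|f y t| <= G y.
Proof.
move=> [C [M [C0 fC]]]; exists (fun y => C * total_counts y ^+ M).
  apply: (polyb_integrable l_gt0 poisson (f := fun y => C * total_counts y ^+ M)); exists C, M; split=> // y t _.
  rewrite ger0_norm// mulr_ge0// exprn_ge0// (le_trans ler01)//.
  exact: total_counts_ge1.
split=> // y; rewrite mulr_ge0// exprn_ge0// (le_trans ler01)//.
exact: total_counts_ge1.
Qed.

Lemma mean_continuous f : polyb f ->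
  (forall y t, 0 <= t <= 1 -> {for t, continuous (f y)}) ->
  continuous (fun t => mean (fun y => f y (clamp t))).
Proof.
move=> fb fc t; have [G iG [G0 fG]] := polyb_dominated fb.
have := @continuity_under_integral R d T P
  (fun t w => f (counts I w) (clamp t)) setT measurableT (t - 1) (t + 1).
move=> /(_ _ _ (fun w => G (counts I w))); apply => //.
- move=> s _; apply: (polyb_integrable l_gt0 poisson (f := fun y => f y (clamp s))).
  exact: polyb_at (clamp_itv _) fb.
- apply: aeW => w _ s _.
  apply: (@continuous_comp _ _ _ clamp (f (counts I w))); first exact: clamp_continuous.
  exact/fc/clamp_itv.
- by move=> s _; apply: aeW => w _; exact/fG/clamp_itv.
- by rewrite inE /= in_itv /= ltrBlDr ltrDl ltr01.
Qed.

Lemma mean_derive f k (t : R) : polyb f -> polyb k ->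
  (forall y (s : R), 0 <= s <= 1 -> is_derive s 1 (f y) (k y s)) -> 0 < t < 1 ->
  is_derive t 1 (fun s => mean (f^~ s)) (mean (k^~ t)).
Proof.
move=> fb kb fk t01; have [G iG [G0 kG]] := polyb_dominated kb.
have sub s : [set` `]0, 1[%R] s -> 0 <= s <= 1.
  by rewrite /= in_itv /= => /andP[s0 s1]; rewrite !ltW.
have It : [set` `]0, 1[%R] t by rewrite /= in_itv.
have E s y : 0 <= s <= 1 -> partial1of2 (fun s w => f (counts I w) s) s y = k (counts I y) s.
  by move=> s01; rewrite partial1of2E; have [] := fk (counts I y) s s01.
have H := @cvg_differentiation_under_integral R d T P
  (fun t w => f (counts I w) t) setT measurableT t 0 1 It.
have {}H := H _ _ (fun w => G (counts I w)) _ iG _.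
have {}H : h^-1 *: (mean (f^~ (h + t)) - mean (f^~ t)) @[h --> 0^'] --> mean (k^~ t).
  rewrite (_ : mean (k^~ t) = \int[P]_(y in setT) partial1of2 (fun s w => f (counts I w) s) t y); last first.
    by apply: eq_Rintegral => w _; rewrite E// sub.
  apply: H => //.
  - by move=> s /sub s01; apply: (polyb_integrable l_gt0 poisson (f := f^~ s)); exact: polyb_at fb.
  - by move=> s w /sub s01 _; have [] := fk (counts I w) s s01.
  - by move=> s w /sub s01 _; rewrite E//; exact: kG.
have EE : (fun h : R => h^-1 *: (mean (f^~ (h *: 1 + t)) - mean (f^~ t)))
    = (fun h : R => h^-1 *: (mean (f^~ (h + t)) - mean (f^~ t))).
  apply/funext => h; congr (_ *: (mean _ - _)); apply/funext => y.
  by rewrite /GRing.scale /= mulr1.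
apply: DeriveDef; first by rewrite /derivable EE; exact: cvgP H.
by rewrite /derive EE; exact: cvg_lim H.
Qed.

Lemma mean_ext (f k : Y -> R) : (forall y, f y = k y) -> mean f = mean k.
Proof. by move=> /funext ->. Qed.

(* Integral form of the remainder would need Fubini; instead Rolle is applied to
   [t |-> E[X q_t] - (1 - t)^2 E[X q_0]] with [q_t = phi 1 - phi t - (1 - t) phi' t],
   where differentiating [q] leaves only [- (1 - t) phi'' t]. *)
Lemma mean_taylor (X : Y -> R) (phi phi1 phi2 : Y -> R -> R) :
  polyb (fun y _ => X y) -> polyb phi -> polyb phi1 -> polyb phi2 ->
  (forall y (s : R), 0 <= s <= 1 -> is_derive s 1 (phi y) (phi1 y s)) ->
  (forall y (s : R), 0 <= s <= 1 -> is_derive s 1 (phi1 y) (phi2 y s)) ->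
  exists2 c, 0 <= c <= 1 &
    mean (fun y => X y * (phi y 1 - phi y 0 - phi1 y 0)) =
    mean (fun y => X y * (phi2 y c / 2)).
Proof.
move=> Xb b0 b1 b2 d1 d2.
pose q y t := X y * (phi y 1 - phi y t - (1 - t) * phi1 y t).
pose q1 y t := X y * (- (1 - t) * phi2 y t).
have i0 : 0 <= (0 : R) <= 1 by rewrite lexx ler01.
have i1 : 0 <= (1 : R) <= 1 by rewrite lexx ler01.
have tb : polyb (fun (_ : Y) (t : R) => 1 - t) := polybB (polyb_cst 1) polyb_t.
have qb : polyb q.
  exact: polybM Xb (polybB (polybB (polyb_at i1 b0) b0) (polybM tb b1)).
have q1b : polyb q1 := polybM Xb (polybM (polybN tb) b2).
have dq y (s : R) : 0 <= s <= 1 -> is_derive s 1 (q y) (q1 y s).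
  move=> s01; have D1 := d1 y s s01; have D2 := d2 y s s01.
  have D : is_derive s 1 (cst (phi y 1) - phi y - (cst 1 - id) * phi1 y)
     (- (1 - s) * phi2 y s).
    have H := is_deriveB (is_deriveB (is_derive_cst (phi y 1) s 1) D1)
      (is_deriveM (is_deriveB (is_derive_cst (1 : R) s 1) (is_derive_id s 1)) D2).
    apply: (is_derive_eq H).
    rewrite -[LHS]/(0 - phi1 y s - ((1 - s) * phi2 y s + phi1 y s * (0 - 1))).
    ring.
  exact: (is_derive_eq (is_deriveZ (X y) D)).
have qc := mean_continuous qb (fun y t t01 => is_derive1_continuous (dq y t t01)).
pose Q0 := mean (q^~ 0).
pose Phi t := mean (fun y => q y (clamp t)) - Q0 * (1 - t) ^+ 2.
have Phi0 : Phi 0 = 0.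
  by rewrite /Phi clamp_id// subr0 expr1n mulr1 subrr.
have Phi1 : Phi 1 = 0.
  rewrite /Phi clamp_id// subrr expr0n mulr0 subr0 -[RHS](mean_cst I 0).
  by apply: mean_ext => y; rewrite /q; ring.
have dPhi (c : R) : 0 < c < 1 -> is_derive c 1 Phi (mean (q1^~ c) + 2 * Q0 * (1 - c)).
  move=> c01; have D := mean_derive qb q1b dq c01.
  have Dp : is_derive c 1 (fun t : R => - Q0 * (1 - t) ^+ 2) (2 * Q0 * (1 - c)).
    by apply: (is_derive_quadratic (Q := - Q0)) => h; rewrite /GRing.scale /=; ring.
  apply: near_eq_is_derive (is_deriveD D Dp).
  have c01' : c \in `]0, 1[ by rewrite in_itv.
  near=> t; have : t \in `]0, 1[ by near: t; exact: near_in_itvoo.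
  rewrite in_itv => /andP[/ltW t0 /ltW t1].
  by rewrite /Phi clamp_id ?t0// !fctE mulNr.
have Phic : continuous Phi.
  move=> t; apply: cvgB; first exact: qc.
  apply: cvgMr; apply: cvgM; apply: cvgB; do ?[exact: cvg_cst|exact: cvg_id].
have [t||c c01 dc] := @Rolle R Phi 0 1 ltr01 _ _ (etrans Phi0 (esym Phi1)).
- by rewrite in_itv => /dPhi [].
- exact: continuous_subspaceT.
have {}c01 : 0 < c < 1 by move: c01; rewrite in_itv.
have c01' : 0 <= c <= 1 by case/andP: c01 => /ltW -> /ltW ->.
exists c => //.
have [_ E] := dPhi c c01; have [_] := dc; rewrite E {E}.
have -> : mean (q1^~ c) = - (2 * (1 - c)) * mean (fun y => X y * (phi2 y c / 2)).
  rewrite -(meanZ l_gt0 poisson).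
    by apply: mean_ext => y; rewrite /q1; field.
  apply: polybM Xb (polybM (polyb_at c01' b2) (polyb_cst _)).
set m := mean _ => H.
have -> : mean (fun y => X y * (phi y 1 - phi y 0 - phi1 y 0)) = Q0.
  by apply: mean_ext => y; rewrite /q; ring.
have c1 : 1 - c != 0 by rewrite subr_eq0 gt_eqF//; case/andP: c01.
(* The point given by Rolle's theorem is interior, so the factor [1 - c] can be cancelled. *)
have : 2 * (1 - c) * (Q0 - m) = 0 by rewrite -H; ring.
move=> /eqP; rewrite mulf_eq0 mulf_eq0 pnatr_eq0 (negbTE c1) /= subr_eq0.
by move/eqP.
Unshelve. all: end_near. Qed.

Lemma is_max01_exists (h : R -> R) (F : R -> \bar R) :
  continuous h -> (forall t, 0 <= t <= 1 -> F t = (h t)%:E) ->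
  exists m, is_max01 F m /\ forall t, 0 <= t <= 1 -> h t <= m.
Proof.
move=> hc Fh; have [|c c01 cmax] := @EVT_max R h 0 1 ler01.
  exact: continuous_subspaceT.
have itv (t : R) : (t \in `[0, 1]) = (0 <= t <= 1) by rewrite in_itv.
exists (h c); split; last by move=> t t01; apply: cmax; rewrite itv.
split; first by exists c => //; rewrite Fh// -itv.
by move=> t; rewrite itv => t01; rewrite Fh// lee_fin cmax// itv.
Qed.

End mean_value.

(** * Bias and variance through the Taylor remainder *)

Section moments.
Context {R : realType} {n : nat}.
Context {d : measure_display} {T : measurableType d} {P : probability T R}.
Variable I : 'I_n -> {RV P >-> nat}.
Local Notation Y := ('I_n -> nat).
Variables g l : 'I_n -> R.
Hypothesis l_gt0 : forall i, 0 < l i.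
Hypothesis indep : mutually_independent I.
Hypothesis poisson : forall i (A : set nat), measurable A ->
  distribution P (I i) A = poisson_prob (l i) 0%N A.
Variables i0 h0 : 'I_n.
Hypothesis gih : g i0 != g h0.

Local Notation mean := (mean I).
Let tau' := jacobian_mx (tau_SWLS g) (lam l).

Lemma covariance_mean (f k : Y -> R) :
  polyb (fun y _ => f y) -> polyb (fun y _ => k y) ->
  covariance P (fun w => f (counts I w)) (fun w => k (counts I w)) =
  (mean (fun y => (f y - mean f) * (k y - mean k)))%:E.
Proof.
move=> fb kb; rewrite unlock !(expectation_mean l_gt0 poisson)//.
have b := polybM (polybB fb (polyb_cst (mean f))) (polybB kb (polyb_cst (mean k))).
exact: (expectation_mean l_gt0 poisson b).
Qed.

Lemma curve1_jacobian j y :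
  curve1 g l j y 0 = \sum_h tau' j h * ((y h)%:R - l h).
Proof.
have z0 : positive_cV (segment (lam l) (data y) 0).
  by apply: segment_gt0 => //; rewrite lexx ltr01.
have t01 : 0 <= (0 : R) <= 1 by rewrite lexx ler01.
have [-> _] := derive_tau_segment l_gt0 gih j t01 z0.
by apply: eq_bigr => h _; rewrite segment0 !mxE mulrC.
Qed.

Let lin j (y : Y) := curve1 g l j y 0.
Let err j (t : R) (y : Y) := curve2 g l j y t / 2.
Let rest j (y : Y) := curve g l j y 1 - curve g l j y 0 - curve1 g l j y 0.

Let i0_01 : 0 <= (0 : R) <= 1. Proof. by rewrite lexx ler01. Qed.
Let i1_01 : 0 <= (1 : R) <= 1. Proof. by rewrite lexx ler01. Qed.

Let polyb_lin j : polyb (fun y _ => lin j y).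
Proof. exact: polyb_at i0_01 (polyb_curve1 l_gt0 gih j). Qed.

Let polyb_err j : polyb (fun y t => err j t y).
Proof. exact: polybM (polyb_curve2 l_gt0 gih j) (polyb_cst _). Qed.

Let polyb_rest j : polyb (fun y _ => rest j y).
Proof.
have b := polyb_curve l_gt0 gih j.
exact: polybB (polybB (polyb_at i1_01 b) (polyb_at i0_01 b)) (polyb_lin j).
Qed.

Lemma mean_lin j : mean (lin j) = 0.
Proof.
have bt i : polyb (fun (y : Y) (_ : R) => tau' j i * ((y i)%:R - l i)).
  exact: polybM (polyb_cst _) (polybB (polyb_count i) (polyb_cst _)).
rewrite (mean_ext I (fun y => curve1_jacobian j y)) (mean_sum l_gt0 poisson)//.
rewrite big1// => i _; rewrite (meanZ l_gt0 poisson); last first.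
  exact: polybB (polyb_count i) (polyb_cst _).
rewrite (meanD l_gt0 poisson (polyb_count i) (polyb_cst _)).
by rewrite (mean_count l_gt0 poisson) mean_cst subrr mulr0.
Qed.

Lemma mean_lin_sqr j : mean (fun y => lin j y * lin j y) =
  (tau' *m diag_mx (lam l)^T *m tau'^T) j j.
Proof.
have bc i : polyb (fun (y : Y) (_ : R) => (y i)%:R - l i).
  exact: polybB (polyb_count i) (polyb_cst _).
rewrite (@mean_ext _ _ _ _ _ I _ (fun y => \sum_i \sum_h (tau' j i * tau' j h)
    * (((y i)%:R - l i) * ((y h)%:R - l h)))); last first.
  move=> y; rewrite /lin curve1_jacobian big_distrlr /=.
  by apply: eq_bigr => i _; apply: eq_bigr => h _; rewrite mulrACA.
have bih i h : polyb (fun (y : Y) (_ : R) => (tau' j i * tau' j h)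
    * (((y i)%:R - l i) * ((y h)%:R - l h))).
  exact: polybM (polyb_cst _) (polybM (bc i) (bc h)).
rewrite (mean_sum l_gt0 poisson); last by move=> i; apply: polyb_sum.
rewrite mxE; apply: eq_bigr => i _; rewrite (mean_sum l_gt0 poisson)// (bigD1 i)//=.
rewrite (meanZ l_gt0 poisson); last exact: polybM.
rewrite (mean_covariance l_gt0 indep poisson) eqxx big1 ?addr0; last first.
  move=> h hi; rewrite (meanZ l_gt0 poisson); last exact: polybM.
  by rewrite (mean_covariance l_gt0 indep poisson) eq_sym (negbTE hi) mulr0.
by rewrite mul_mx_diag !mxE; ring.
Qed.

Lemma mean_rest j (X : Y -> R) : polyb (fun y _ => X y) ->
  exists2 c, 0 <= c <= 1 &
    mean (fun y => X y * rest j y) = mean (fun y => X y * err j c y).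
Proof.
move=> Xb; have D y s : 0 <= s <= 1 -> (denom g l y).[s] != 0.
  by move=> s01; rewrite gt_eqF// (denom_gt0 l_gt0 gih).
apply: (mean_taylor l_gt0 poisson Xb (polyb_curve l_gt0 gih j)
  (polyb_curve1 l_gt0 gih j) (polyb_curve2 l_gt0 gih j)) => y s s01.
- exact/is_derive_curve/D.
- exact/is_derive_curve1/D.
Qed.

Lemma mean_err_continuous j (X : Y -> R -> R) : polyb X ->
  (forall y t, 0 <= t <= 1 -> {for t, continuous (X y)}) ->
  continuous (fun t => mean (fun y => X y (clamp t) * err j (clamp t) y)).
Proof.
move=> Xb Xc; apply: (mean_continuous l_gt0 poisson (f := fun y t => X y t * err j t y)).
  exact: polybM Xb (polyb_err j).
move=> y t t01; apply: cvgM; first exact: Xc.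
apply: cvgMl; apply: curve2_continuous.
by rewrite gt_eqF// (denom_gt0 l_gt0 gih).
Qed.

(** The null count vector is an arbitrary choice: at 0 every curve starts from the estimator at the
    mean. *)
Lemma mean_tau_rest j : mean (fun y => curve g l j y 1) =
  curve g l j (fun=> 0%N) 0 + mean (rest j).
Proof.
rewrite (@mean_ext _ _ _ _ _ I _ (fun y => lin j y + (rest j y + curve g l j (fun=> 0%N) 0))).
  rewrite (meanD l_gt0 poisson) ?mean_lin ?add0r; last 2 first.
  - exact: polyb_lin.
  - exact: polybD (polyb_rest j) (polyb_cst _).
  rewrite (meanD l_gt0 poisson) ?mean_cst 1?addrC//; last exact: polyb_cst.
move=> y; rewrite /rest /lin -(tau_lam_curve l_gt0 gih j (fun=> 0%N)).
by rewrite (tau_lam_curve l_gt0 gih j y); ring.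
Qed.

(** The estimator is a constant plus [lin + rest] and [lin] has mean 0; the last bracket is the
    variance of [rest]. *)
Lemma variance_tau j : let f y := curve g l j y 1 in
  mean (fun y => (f y - mean f) * (f y - mean f)) =
  mean (fun y => lin j y * lin j y) + 2 * mean (fun y => lin j y * rest j y)
  + (mean (fun y => rest j y * rest j y) - mean (rest j) ^+ 2).
Proof.
move=> f; rewrite /f mean_tau_rest; set m := mean (rest j).
have bL := polyb_lin j; have bS := polyb_rest j.
have b2 c X := @polybM R n (fun _ _ => c) (fun y _ => X y) (polyb_cst c).
rewrite (@mean_ext _ _ _ _ _ I _ (fun y => lin j y * lin j y + (2 * (lin j y * rest j y)
   + (rest j y * rest j y + ((- 2 * m) * lin j y + ((- 2 * m) * rest j y + m * m)))))); last first.
  move=> y; rewrite -(tau_lam_curve l_gt0 gih j (fun=> 0%N)).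
  by rewrite (tau_lam_curve l_gt0 gih j y) /rest /lin; ring.
have p1 := polybM bL bL; have p2 := b2 2 _ (polybM bL bS); have p3 := polybM bS bS.
have p4 := b2 (- 2 * m) _ bL; have p5 := b2 (- 2 * m) _ bS.
have p6 := @polyb_cst R n (m * m).
have q5 := polybD p5 p6; have q4 := polybD p4 q5; have q3 := polybD p3 q4.
have q2 := polybD p2 q3.
rewrite (meanD l_gt0 poisson p1 q2) (meanD l_gt0 poisson p2 q3).
rewrite (meanD l_gt0 poisson p3 q4) (meanD l_gt0 poisson p4 q5).
rewrite (meanD l_gt0 poisson p5 p6) mean_cst.
rewrite (meanZ l_gt0 poisson 2 (polybM bL bS)) (meanZ l_gt0 poisson _ bL).
rewrite (meanZ l_gt0 poisson _ bS) mean_lin -/m; ring.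
Qed.

(** Taking [X = rest], the mean of the square equals the mean of [rest * err] at some [c]; then
    [2 * a * b <= a ^+ 2 + b ^+ 2] absorbs half of it. *)
Lemma mean_rest_sqr j : exists2 c, 0 <= c <= 1 &
  mean (fun y => rest j y * rest j y) <= mean (fun y => err j c y * err j c y).
Proof.
have bS := polyb_rest j; have [c c01 H] := mean_rest j bS; exists c => //.
have bE := polyb_at c01 (polyb_err j).
have : mean (fun y => 2 * (rest j y * err j c y)) <=
    mean (fun y => rest j y * rest j y + err j c y * err j c y).
  apply: (mean_le l_gt0 poisson).
  - exact: polybM (polyb_cst _) (polybM bS bE).
  - exact: polybD (polybM bS bS) (polybM bE bE).
  - move=> y; rewrite -subr_ge0.
    have -> : rest j y * rest j y + err j c y * err j c y - 2 * (rest j y * err j c y)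
      = (rest j y - err j c y) ^+ 2 by ring.
    exact: sqr_ge0.
rewrite (meanZ l_gt0 poisson _ (polybM bS bE)).
rewrite (meanD l_gt0 poisson (polybM bS bS) (polybM bE bE)) -H; lra.
Qed.

(** Nonnegativity of the variance; for [rest] it serves the lower bound on the variance of the
    estimator. *)
Lemma mean_sqr_le (X : Y -> R) : polyb (fun y _ => X y) ->
  mean X ^+ 2 <= mean (fun y => X y * X y).
Proof.
move=> Xb; pose m := mean X.
have : mean (fun=> 0) <= mean (fun y => X y * X y + ((- 2 * m) * X y + m * m)).
  apply: (mean_le l_gt0 poisson); first exact: polyb_cst.
    exact: polybD (polybM Xb Xb) (polybD (polybM (polyb_cst _) Xb) (polyb_cst _)).
  move=> y; have -> : X y * X y + ((- 2 * m) * X y + m * m) = (X y - m) ^+ 2 by ring.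
  exact: sqr_ge0.
have p2 := polybM (polyb_cst (- 2 * m)) Xb; have p3 := @polyb_cst R n (m * m).
rewrite (meanD l_gt0 poisson (polybM Xb Xb) (polybD p2 p3)) (meanD l_gt0 poisson p2 p3).
rewrite (meanZ l_gt0 poisson _ Xb) !mean_cst -/m expr2; lra.
Qed.

End moments.

(** * Bias and variance bounds for the pixel model *)

Theorem theorem5p2 (R : realType) (n : nat) (x : 'I_n -> R)
    (dx sigma xc F B : R)
    (dx_gt0 : 0 < dx)
    (x_spacing : forall i h : 'I_n, h = i.+1 :> nat -> x h - x i = dx)
    (sigma_gt0 : 0 < sigma)
    (d : measure_display) (T : measurableType d) (P : probability T R)
    (I : 'I_n -> {RV P >-> nat}) :
  let g := pixel_response sigma dx x xc in
  let alpha : 'cV[R]_2 := \col_k (if k == 0 then F else B) in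
  let lambda : 'cV[R]_n := \col_i (F * g i + B) in
  let K : 'M[R]_n := diag_mx lambda^T in
  let Ivec := fun w : T => (\col_i (I i w)%:R) : 'cV[R]_n in
  let count := fun (i : 'I_n) (w : T) => Ivec w i 0 in
  let J := J_SWLS g in
  let tau := tau_SWLS g in
  let tauI := fun (j : 'I_2) (w : T) => tau (Ivec w) j 0 in
  let tau' := jacobian_mx tau lambda in
  let sigma2 := tau' *m K *m tau'^T in
  let e := fun (j : 'I_2) (t : R) (w : T) => remainder g j lambda (Ivec w) t in
  let lin := fun (j : 'I_2) (w : T) => (row j tau' *m (Ivec w - lambda)) 0 0 in
  Theta alpha ->
  mutually_independent I ->
  (forall (i : 'I_n) (A : set nat), measurable A ->
    distribution P (I i) A = poisson_prob (lambda i 0) 0%N A) ->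
  gram g lambda \in unitmx ->
  (* mean and covariance matrix of the counts *)
  [/\ (forall i, 'E_P[count i]%E = (lambda i 0)%:E)
    & (forall i h, covariance P (count i) (count h) = (K i h)%:E)] /\
  (* the closed form is the argmin over Theta, whenever the latter exists *)
  (forall y : 'cV[R]_n, positive_cV y ->
    argmin Theta (J ^~ y) = Theta `&` [set tau y]) /\
  (* the limits defining the estimator and the remainder at null counts exist *)
  (forall (y : 'cV[R]_n) (j : 'I_2), (forall i, 0 <= y i 0) ->
    SWLS_closed_form g z j 0 @[z --> within [set z | positive_cV z] (nbhs y)]
      --> tau y j 0) /\
  (forall (w : T) (j : 'I_2),
    remainder_formula g j lambda (Ivec w) u @[u --> 1^'-] --> e j 1 w) /\
  (* the Jacobian of the estimator at the mean *)
  [/\ tau' = - (invmx (nabla20 J (tau lambda) lambda)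
                *m nabla11 J (tau lambda) lambda),
      nabla11 J (tau lambda) lambda
      = 2 *: (\matrix_(k < 2, i < n)
               (if k == 0 then - g i / lambda i 0 else -1 / lambda i 0))
    & nabla20 J (tau lambda) lambda
      = 2 *: (\matrix_(k < 2, l < 2)
               (if (k == 0) && (l == 0) then \sum_(i < n) g i ^+ 2 / lambda i 0
                else if (k == 0) || (l == 0) then \sum_(i < n) g i / lambda i 0
                else \sum_(i < n) 1 / lambda i 0))] /\
  (* the bounds on the bias and on the variance *)
  (forall j : 'I_2, exists eps beta m1 m2 m3 : R,
    [/\ is_max01 (fun t => `| 'E_P[e j t] |)%E m1,
        is_max01 (fun t => 'E_P[fun w => (e j t w ^+ 2)%R])%E m2
      & is_max01 (fun t => `| 'E_P[fun w => (lin j w * e j t w)%R] |)%E m3] /\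
    [/\ eps = `| tau lambda j 0 - alpha j 0 | + m1,
        beta = m2 + 2 * m3,
        0 <= eps
      & ((exists2 t, t \in `[0, 1] & ('E_P[e j t] != 0)%E) -> 0 < eps)] /\
    [/\ (`| 'E_P[tauI j] - (alpha j 0)%:E | <= eps%:E)%E,
        ((sigma2 j j - beta)%:E <= 'V_P[tauI j])%E
      & ('V_P[tauI j] <= (sigma2 j j + beta)%:E)%E]).
Proof.
have g0 i : 0 <= pixel_response sigma dx x xc i.
  by apply: Rintegral_ge0 => z _; exact: normal_pdf_ge0.
move=> g alpha lambda K Ivec count J tau tauI tau' sigma2 e lin.
move=> [F0 B0] indep poisson gu.
have {}F0 : 0 < F by move: F0; rewrite mxE.
have {}B0 : 0 < B by move: B0; rewrite mxE.
pose l i := F * g i + B.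
have l0 i : 0 < l i by rewrite ltr_wpDl// mulr_ge0// ltW.
have lE i : lambda i 0 = l i by rewrite mxE.
have {}poisson i (A : set nat) : measurable A ->
    distribution P (I i) A = poisson_prob (l i) 0%N A.
  by move=> mA; rewrite poisson// lE.
have lam0 : positive_cV lambda by apply/positive_cVP => i; rewrite lE.
have [i0 [h0 gih]] := gram_unit_neq gu.
have tauE : tau lambda = alpha.
  by apply: SWLS_model => // i; rewrite !mxE /= mulrC.
have tauJ : tau' = invmx (gram g lambda) *m weighted_design g lambda.
  by apply: jacobian_tau => // i; rewrite -/tau tauE !mxE /= mulrC.
have J11 : nabla11 J (tau lambda) lambda = - 2 *: weighted_design g lambda.
  rewrite nabla11_J//; apply/matrixP => k i; rewrite mxE.
  (* At the mean the model value is the Poisson parameter, which cancels one of the two powers in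
     the denominator. *)
  have -> : model g (tau lambda) i = l i by rewrite tauE /model !mxE.
  have li := lt0r_neq0 (l0 i).
  rewrite lE [RHS]mxE [in RHS]mxE lE; field; exact: li.
have J20 : nabla20 J (tau lambda) lambda = 2 *: gram g lambda by exact: nabla20_J.
have eE j t w : 0 <= t <= 1 -> e j t w = curve2 g l j (counts I w) t / 2.
  exact: (remainder_curve l0 gih).
have tE j w : tauI j w = curve g l j (counts I w) 1.
  exact: (tau_data_curve l0 gih).
have linE j w : lin j w = curve1 g l j (counts I w) 0.
  rewrite (curve1_jacobian l0 gih) /lin mxE; apply: eq_bigr => i _.
  by rewrite !mxE.
have b1 (i : 'I_n) := @polyb_count R n i.
split; [split|split; [|split; [|split; [|split]]]].
- move=> i; rewrite lE -(mean_count l0 poisson i) -(expectation_mean l0 poisson (b1 i)).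
  by congr expectation; apply/funext => w; rewrite /count mxE.

- move=> i h; have countE k : count k = fun w => (counts I w k)%:R.
    by apply/funext => w; rewrite /count mxE.
  rewrite !countE (covariance_mean l0 poisson (b1 i) (b1 h)) !(mean_count l0 poisson).
  rewrite (mean_covariance l0 indep poisson) !mxE.
  by case: eqVneq => // ->; rewrite mulr1n.
- move=> y y0; rewrite (argmin_Theta gih y0); congr (_ `&` [set _]).
  by rewrite /tau /tau_SWLS y0.
- by move=> y j y0; exact: (SWLS_cvg gih).
- move=> w j; rewrite eE; last by rewrite ler01 lexx.
  exact: (remainder_formula_cvg l0 gih).
- split.
  + have g2u : 2 *: gram g lambda \in unitmx.
      by rewrite unitmxZ// unitfE pnatr_eq0.
    rewrite tauJ J11 J20 -mulmxN; apply: (canRL (mulKmx g2u)).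
    by rewrite -scalemxAl mulKVmx// scaleNr opprK.
  + rewrite J11; apply/matrixP => k i; rewrite !mxE /design.
    by case: (k == 0); ring.
  + rewrite J20; congr (_ *: _); apply/matrixP => k m; rewrite !mxE.
    rewrite /design; case: (k == 0); case: (m == 0); apply: eq_bigr => i _ //=; by rewrite ?mulr1 ?mul1r ?expr2.
move=> j.
have i0_01 : 0 <= (0 : R) <= 1 by rewrite lexx ler01.
have i1_01 : 0 <= (1 : R) <= 1 by rewrite lexx ler01.
pose L y : R := curve1 g l j y 0; pose E t y : R := curve2 g l j y t / 2.
have bL : polyb (fun (y : 'I_n -> nat) (_ : R) => L y) := polyb_at i0_01 (polyb_curve1 l0 gih j).
have bE : polyb (fun (y : 'I_n -> nat) (t : R) => E t y) := polybM (polyb_curve2 l0 gih j) (polyb_cst _).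
have bC : polyb (fun (y : 'I_n -> nat) t => curve g l j y t) := polyb_curve l0 gih j.
have Ec y (t : R) : 0 <= t <= 1 -> {for t, continuous (fun s => E s y)}.
  move=> t01; apply: cvgMl; apply: curve2_continuous.
  by rewrite gt_eqF// (denom_gt0 l0 gih).
have Xe (X : ('I_n -> nat) -> R -> R) (t : R) : polyb X -> 0 <= t <= 1 ->
    ('E_P[fun w => (X (counts I w) t * e j t w)%R] = (mean I (fun y => (X y t * E t y)%R))%:E)%E.
  move=> Xb t01.
  rewrite -(expectation_mean l0 poisson (polyb_at t01 (polybM Xb bE))).
  by congr expectation; apply/funext => w; rewrite eE.
(* The factor 1 is kept so that the bias is the case [X = 1] of the same continuity and mean-value
   results. *)
have e1 (t : R) : 0 <= t <= 1 -> ('E_P[e j t] = (mean I (fun y => (1 * E t y)%R))%:E)%E.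
  move=> t01; rewrite -(Xe (fun _ _ => 1) t (polyb_cst 1) t01).
  by congr expectation; apply/funext => w; rewrite mul1r.
have Xc X := @mean_err_continuous _ _ _ _ _ I g l l0 poisson _ _ gih j X.
have [m1 [M1 M1le]] : exists m, is_max01 (fun t => `| 'E_P[e j t] |)%E m /\
    forall t, 0 <= t <= 1 -> `|mean I (fun y => 1 * E t y)| <= m.
  have C := Xc _ (polyb_cst 1) (fun _ _ _ => cvg_cst _).
  have [||m [Mm mle]] := @is_max01_exists R
    (fun t => `|mean I (fun y => 1 * E (clamp t) y)|) (fun t => `| 'E_P[e j t] |)%E.
  - by move=> t; apply: cvg_norm; exact: C.
  - by move=> t t01; rewrite e1// clamp_id.
  by exists m; split=> // t t01; have := mle t t01; rewrite clamp_id.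
have [m2 [M2 M2le]] : exists m, is_max01 (fun t => 'E_P[fun w => (e j t w ^+ 2)%R])%E m /\
    forall t, 0 <= t <= 1 -> mean I (fun y => E t y * E t y) <= m.
  have C := Xc (fun y t => E t y) bE Ec.
  have [|m [Mm mle]] := is_max01_exists (F := fun t => 'E_P[fun w => (e j t w ^+ 2)%R]%E) C.
    move=> t t01; rewrite clamp_id// -(Xe (fun y t => E t y))//.
    by congr expectation; apply/funext => w; rewrite eE.
  by exists m; split=> // t t01; have := mle t t01; rewrite clamp_id.
have [m3 [M3 M3le]] : exists m, is_max01 (fun t => `| 'E_P[fun w => (lin j w * e j t w)%R] |)%E m /\
    forall t, 0 <= t <= 1 -> `|mean I (fun y => L y * E t y)| <= m.
  have C := Xc (fun y _ => L y) bL (fun _ _ _ => cvg_cst _).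
  have [||m [Mm mle]] := @is_max01_exists R
    (fun t => `|mean I (fun y => L y * E (clamp t) y)|)
    (fun t => `| 'E_P[fun w => (lin j w * e j t w)%R] |)%E.
  - by move=> t; apply: cvg_norm; exact: C.
  - move=> t t01; rewrite clamp_id//.
    rewrite (_ : (fun w => _) = (fun w => L (counts I w) * e j t w)).
      by rewrite (Xe (fun y _ => L y)).
    by apply/funext => w; rewrite linE.
  by exists m; split=> // t t01; have := mle t t01; rewrite clamp_id.
exists (`| tau lambda j 0 - alpha j 0 | + m1), (m2 + 2 * m3), m1, m2, m3.
have m1_ge0 : 0 <= m1 by apply: le_trans (M1le 0 i0_01).
split; first by split.
(* The estimator is exact at the mean, so the bias bound reduces to [m1]. *)
rewrite tauE subrr normr0 add0r; split; first split => //.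
  move=> [t t01]; rewrite in_itv /= in t01; rewrite e1// => Et.
  by apply: lt_le_trans (M1le t t01); rewrite normr_gt0; move: Et; rewrite eqe.
pose f (y : 'I_n -> nat) := curve g l j y 1.
have bf : polyb (fun y _ => f y) := polyb_at i1_01 bC.
have tauIE : tauI j = fun w => f (counts I w) by apply/funext => w; exact: tE.
have Ef : ('E_P[tauI j] = (mean I f)%:E)%E by rewrite tauIE (expectation_mean l0 poisson bf).
have Vf : 'V_P[tauI j] = (mean I (fun y => (f y - mean I f) * (f y - mean I f)))%:E.
  by rewrite /variance tauIE (covariance_mean l0 poisson bf bf).
have s2 : mean I (fun y => L y * L y) = sigma2 j j := mean_lin_sqr l0 indep poisson gih j.
(* The points [c1], [c2] and [c3] are unrelated; each expectation is compared with its own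
   maximum. *)
have [c1 c1_01 H1] := mean_rest l0 poisson gih j (polyb_cst 1).
have [c2 c2_01 H2] := mean_rest l0 poisson gih j bL.
have [c3 c3_01 H3] := mean_rest_sqr l0 poisson gih j.
have f0 : curve g l j (fun=> 0%N) 0 = alpha j 0.
  by rewrite -(tau_lam_curve l0 gih) -tauE.
have r1 : `|mean I (fun y => curve g l j y 1 - curve g l j y 0 - curve1 g l j y 0)| <= m1.
  apply: le_trans (M1le c1 c1_01); rewrite -H1 le_eqVlt; apply/orP; left.
  by apply/eqP; congr `|_|; apply: mean_ext => y; rewrite mul1r.
have lr := M3le c2 c2_01; rewrite -H2 in lr.
have rr := le_trans H3 (M2le c3 c3_01).
have sq := mean_sqr_le l0 poisson
  (polybB (polybB (polyb_at i1_01 bC) (polyb_at i0_01 bC)) bL).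
(* Here [b] is the mean of the first-order term times the Taylor remainder, while [c] and [q] are
   the second moment and the mean of the remainder; [c - q ^+ 2] lies between 0 and [m2]. *)
have alg (s b c q : R) : `|b| <= m3 -> c <= m2 -> q ^+ 2 <= c ->
    s - (m2 + 2 * m3) <= s + 2 * b + (c - q ^+ 2) <= s + (m2 + 2 * m3).
  rewrite ler_norml => /andP[b0 b1'] cm qc; have := sqr_ge0 q => q0.
  by apply/andP; split; lra.
rewrite Ef Vf !lee_fin (variance_tau l0 poisson gih) (mean_tau_rest l0 poisson gih) f0.
split; first by move: r1; rewrite addrC addKr.
all: rewrite [X in X + 2 * _ + _]s2.
all: by have /andP[] := alg (sigma2 j j) _ _ _ lr rr sq.
Qed.
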